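(* Let $q>2$ be a prime power. The number $M(q)$ of $\mathbb{F}_{q^4}$-linear MRD codes of dimension $2$ in $\mathcal{L}_{4,q}[x]$ is $$M(q)=\frac12\, q^7(q^3-1)(q^2-1)(q-1)(q^3-q^2-q-1).$$
   Context: For a prime power $q$ and $m\ge 1$, $\mathcal{L}_{m,q}[x]$ is the set of linearized polynomials $f=\sum_{i=0}^{m-1} f_i x^{q^i}$ with $f_i\in\mathbb{F}_{q^m}$ (i.e. $q$-polynomials modulo $x^{q^m}-x$), an $m$-dimensional $\mathbb{F}_{q^m}$-vector space under left multiplication by scalars, identified with $\mathrm{End}_{\mathbb{F}_q}(\mathbb{F}_{q^m})$ via evaluation. The rank of $f$ is $\mathrm{rk}(f)=\dim_{\mathbb{F}_q}(\mathrm{Im} f)$. An $\mathbb{F}_{q^m}$-linear rank-metric code in $\mathcal{L}_{m,q}[x]$ is a nonzero $\mathbb{F}_{q^m}$-linear subspace; its dimension is its $\mathbb{F}_{q^m}$-dimension. A code of dimension $k$ is MRD if the minimum rank of its nonzero elements equals $m-k+1$. *)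

(* Defs.v *)
From HB Require Import structures.
From mathcomp Require Import all_boot all_algebra all_field.
From mathcomp Require Import qpoly finmap.
From mathcomp Require Import boolp classical_sets functions cardinality.

Set Implicit Arguments.
Unset Strict Implicit.
Unset Printing Implicit Defensive.

Import GRing.Theory.
Local Open Scope classical_set_scope.
Local Open Scope ring_scope.

(* Throughout, F is the field F_q with q = #|F|, and L is an extension of F of
   degree m = \dim {:L}, i.e. the field F_(q^m). *)
Section LinearizedPolynomials.
Variables (F : finFieldType) (L : fieldExtType F).

Local Notation q := #|F|.
Local Notation m := (\dim {:L}).

(* The degree of a linearized polynomial is at most q ^ (m - 1). *)
Definition ambient := {poly_((q ^ m.-1).+1) L}.

(* npolyp truncates to the bounded type, but none of these monomials is
   affected; see linearizedP. *)
Definition linearized : {vspace ambient} :=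
  <<[tuple (npolyp (q ^ m.-1).+1 'X^(q ^ i) : ambient) | i < m]>>%VS.

(* When f \in linearized, evaluation of f is F-linear, so that linfun does
   return this map; see polyendE. *)
Definition polyend (f : {poly L}) : 'End(L) := linfun (fun x : L => f.[x]).

Definition rk (f : {poly L}) : nat := \dim (limg (polyend f)).

Definition rank_metric_code (C : {vspace ambient}) : Prop :=
  (C <= linearized)%VS /\ C <> 0%VS.

Definition is_min_rank (C : {vspace ambient}) (d : nat) : Prop :=
  (exists f : ambient, [/\ f \in C, f != 0 & rk f = d]) /\
  (forall f : ambient, f \in C -> f != 0 -> (d <= rk f)%N).

(* \dim C is the dimension over L; it is at most m for a code C, so the
   subtraction is not truncated. *)
Definition is_MRD (C : {vspace ambient}) : Prop :=
  rank_metric_code C /\ is_min_rank C (m - \dim C + 1).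

(* The set is finite because L is; fset_set would send an infinite set to the
   empty one. *)
Definition num_MRD (k : nat) : nat :=
  #|` fset_set [set C : {vspace ambient} | is_MRD C /\ \dim C = k]|.

Lemma linearizedP (f : ambient) :
  f \in linearized <->
  exists c : 'I_m -> L, f = \sum_(i < m) c i *: 'X^(q ^ i) :> {poly L}.
Proof.
have m_gt0 : (0 < m)%N by rewrite adim_gt0.
have q_gt0 : (0 < q)%N := ltnW (finNzRing_gt1 F).
pose s : m.-tuple ambient := [tuple (npolyp _ 'X^(q ^ i) : ambient) | i < m].
have sE (i : 'I_m) : s`_i = 'X^(q ^ i) :> {poly L}.
  rewrite -tnth_nth tnth_mktuple npolypK // size_polyXn ltnS leq_pexp2l //.
  by rewrite -ltnS prednK.
have valsum (c : 'I_m -> L) :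
    polyn (\sum_(i < m) c i *: s`_i) = \sum_(i < m) c i *: 'X^(q ^ i).
  by rewrite raddf_sum; apply: eq_bigr => i _; rewrite /= sE.
split=> [fs | [c fE]].
  exists (fun i => coord s i f).
  by rewrite -valsum -(coord_span fs).
have -> : f = \sum_(i < m) c i *: s`_i by apply: val_inj; rewrite /= fE valsum.
apply: rpred_sum => i _; apply: rpredZ; apply: memv_span.
by rewrite mem_nth ?size_tuple.
Qed.

Lemma polyendE (f : ambient) (x : L) : f \in linearized -> polyend f x = f.[x].
Proof.
move=> /linearizedP[c fE].
have qD i (u v : L) : (u + v) ^+ (q ^ i) = u ^+ (q ^ i) + v ^+ (q ^ i).
  have [p p_pr pchF] := finPcharP F.
  apply: exprDn_pchar; rewrite pnatX (card_pprimeChar pchF) pnatX.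
  by rewrite pnatE // pchar_lalg pchF.
have qZ i (a : F) : a ^+ (q ^ i) = a.
  by elim: i => [|i IHi]; rewrite ?expr1 // expnSr exprM IHi expf_card.
have hE u : f.[u] = \sum_(i < m) c i * u ^+ (q ^ i).
  by rewrite fE horner_sum; apply: eq_bigr => i _; rewrite hornerZ hornerXn.
have flin : linear (fun u : L => f.[u]).
  move=> a u v; rewrite !hE scaler_sumr -big_split; apply: eq_bigr => i _ /=.
  by rewrite qD exprZn qZ mulrDr scalerAr.
pose g : {linear L -> L} := HB.pack (fun u : L => f.[u])
  (GRing.isLinear.Build F L L *:%R (fun u : L => f.[u]) flin).
exact: (lfunE g x).
Qed.

End LinearizedPolynomials.

(* Main.v *)
Require Import Defs.
From HB Require Import structures.
From mathcomp Require Import boolp classical_sets functions cardinality finmap.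
From mathcomp Require Import all_boot all_algebra all_fingroup all_field.
From mathcomp Require Import qpoly ring.
Set Implicit Arguments.
Unset Strict Implicit.
Unset Printing Implicit Defensive.
Import GRing.Theory.
Local Open Scope ring_scope.

(* Write f^s for the composite of a linearized polynomial f with the Frobenius
   x |-> x^q; s is semilinear of order 4 on the 4-dimensional L-space of
   linearized polynomials, and rk f < k holds exactly when f, f^s, .., f^(s^(k-1))
   are linearly dependent over L. Hence a code C is MRD iff no nonzero f in C has
   f, f^s, f^(s^2) dependent.

   If C is MRD then C and C^(s^2) are complementary, since f and f^(s^2) both in C
   would give elements l f + (l f)^(s^2) fixed by s^2, of rank at most 2. Splitting
   f^s along this decomposition gives f^s = theta f + (eta f)^(s^2), where theta
   and eta are semilinear maps on C for the powers 1 and -1 of the Frobenius, with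
   eta theta + theta eta = 1 and theta^2 + eta^2 = 0, and C being MRD forbids common
   eigenvectors of theta and eta. The linear map A = eta theta satisfies
   tr(A)^q = 2 - tr A and det(A)^q = det(1 - A), so its characteristic polynomial
   has coefficients in F_(q^2) and splits over L; theta and eta both send the
   a-eigenspace of A to the (1 - a)^q-eigenspace. It follows that A has two distinct
   eigenlines, swapped by theta and eta, and that C = <g, g^s + b g^(s^3)> for an
   eigenvector g, which has rank 4, and some b with norm N(b) <> 1. Conversely all
   these codes are MRD.

   The code of (g, b) arises from q^4 - 1 pairs when b = 0 and from 2(q^4 - 1) pairs
   otherwise. As there are |GL_4(q)| choices of g and q^4 - (q^3 + q^2 + q + 1)
   choices of b, counting b = 0 twice shows that the number M of codes satisfies
   2 (q^4 - 1) M = |GL_4(q)| (q^4 - q^3 - q^2 - q). *)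

(** * Finite fields *)

Section FiniteField.
Variable E : finFieldType.

Lemma finField_prim_root : {z : E | #|E|.-1.-primitive_root z}.
Proof.
have Egt1 : (1 < #|E|)%N by apply: finNzRing_gt1.
have n0 : (0 < #|E|.-1)%N by rewrite -subn1 subn_gt0.
have : has #|E|.-1.-primitive_root (enum [set x : E | x != 0]).
  apply: cyclic.has_prim_root => //.
  - apply/allP => x; rewrite mem_enum inE => x0; apply/unity_rootP.
    by apply: (mulfI x0); rewrite -exprS prednK ?(ltnW Egt1) // expf_card mulr1.
  - exact: enum_uniq.
  have -> : [set x : E | x != 0] = [set~ 0] by apply/setP=> x; rewrite !inE.
  by rewrite -cardE cardsC1.
by move=> /hasP zP; apply: sigW; have [z _] := zP; exists z.
Qed.

Lemma card_unity_roots n : (n %| #|E|.-1)%N -> #|[set x : E | x ^+ n == 1]| = n.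
Proof.
have [z z_prim] := finField_prim_root.
move=> dvd_n; have := dvdn_prim_root z_prim dvd_n.
set w := z ^+ _ => w_prim.
have -> : [set x : E | x ^+ n == 1] = [set w ^+ i | i : 'I_n].
  apply/setP=> x; rewrite inE; apply/eqP/imsetP =>
    [/(prim_rootP w_prim)[i ->]|].
    by exists i.
  by case=> i _ ->; rewrite exprAC (prim_expr_order w_prim) expr1n.
rewrite card_imset ?card_ord // => i j /eqP.
by rewrite (eq_prim_root_expr w_prim) !modn_small // => /eqP/val_inj.
Qed.

Lemma finField_root_exists n m (c : E) :
  (n * m = #|E|.-1)%N -> c ^+ m = 1 -> exists x, x ^+ n = c.
Proof.
have [z z_prim] := finField_prim_root => nm cm1.
have c1 : c ^+ #|E|.-1 = 1 by rewrite -nm mulnC exprM cm1 expr1n.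
have [[i ltiE] /= ci] := prim_rootP z_prim c1.
have {ltiE} : (#|E|.-1 %| i * m)%N by rewrite (prim_order_dvd z_prim) exprM -ci
  cm1.
have : (0 < #|E|.-1)%N by rewrite -subn1 subn_gt0 finNzRing_gt1.
rewrite -nm muln_gt0 => /andP[_ m0]; rewrite dvdn_pmul2r // => /dvdnP[k ik].
by exists (z ^+ k); rewrite -exprM -ik.
Qed.

(* A monic quadratic over the subfield of order r splits over its quadratic
   extension E: the conjugate of a root a is a^r, so a^(r^2) = a. *)
Lemma quadratic_root r (t d : E) :
    (r * r = #|E|)%N -> [pchar E].-nat r -> t ^+ r = t -> d ^+ r = d ->
  exists a, a ^+ 2 - t * a + d = 0.
Proof.
move=> rE r_pchar tr dr.
pose p : {poly E} := 'X^2 - t *: 'X + d%:P.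
have size_p : size p = 3.
  rewrite /p -addrA size_polyDl ?size_polyXn // ltnS.
  apply: (leq_trans (size_polyD _ _)); rewrite geq_max size_polyN.
  rewrite (leq_trans (size_scale_leq _ _)) ?size_polyX //.
  by rewrite (leq_trans (size_polyC_leq1 _)).
have p0 : p != 0 by rewrite -size_poly_eq0 size_p.
have [K [rs p_rs _]] := FinSplittingFieldFor p0.
have : size rs = 2%N.
  have := eqp_size p_rs; rewrite size_map_poly size_p.
  by rewrite size_prod_XsubC => -[<-].
case: rs p_rs => // a rs /eqp_root/(_ a) pa _.
move: pa; rewrite root_prod_XsubC mem_head /root /p.
rewrite rmorphD rmorphB /= map_polyZ map_polyXn map_polyX map_polyC /=.
rewrite !hornerE; set T := t%:A; set D := d%:A => /eqP pa.
have r_K : [pchar K].-nat r.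
  by apply: sub_in_pnat r_pchar => s _; rewrite pchar_lalg.
have FrD u v : (u + v : K) ^+ r = u ^+ r + v ^+ r by apply: exprDn_pchar.
have r_gt0 : (0 < r)%N by case/andP: r_pchar.
have FrB u v : (u - v : K) ^+ r = u ^+ r - v ^+ r.
  by apply/eqP; rewrite eq_sym subr_eq -FrD subrK.
have Tr : T ^+ r = T by rewrite /T -in_algE -rmorphXn tr.
have Dr : D ^+ r = D by rewrite /D -in_algE -rmorphXn dr.
have par : (a ^+ r) ^+ 2 - T * a ^+ r + D = 0.
  have := congr1 (fun u => u ^+ r) pa.
  by rewrite FrD FrB 2!exprMn Tr Dr expr0n (gtn_eqF r_gt0) -expr2.
have : (a ^+ r - a) * (a ^+ r - (T - a)) = 0.
  by rewrite -[RHS](subrr 0) -{1}par -pa; ring.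
move/eqP; rewrite mulf_eq0 => fixa.
have aE : a ^+ #|E| = a.
  rewrite -rE exprM; case/orP: fixa; rewrite subr_eq0 => /eqP ar.
    by rewrite !ar.
  by rewrite ar FrB Tr ar; ring.
have : root (map_poly (in_alg K) ('X^#|E| - 'X)) a.
  by rewrite /root rmorphB /= map_polyXn map_polyX !hornerE aE subrr.
rewrite finField_genPoly rmorph_prod /= -big_enum /=.
under eq_bigr => x _ do rewrite rmorphB /= map_polyX map_polyC /=.
rewrite -(big_map (in_alg K) xpredT (fun y => 'X - y%:P)) root_prod_XsubC.
case/mapP=> a0 _ a0E; exists a0; apply: (fmorph_inj (in_alg K)).
rewrite a0E in pa; rewrite rmorph0 rmorphD rmorphB rmorphXn rmorphM. exact: pa.
Qed.
End FiniteField.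

Lemma det_mx22 (R : comPzRingType) (A : 'M[R]_2) :
  \det A = A 0 0 * A 1 1 - A 0 1 * A 1 0.
Proof.
rewrite (expand_det_row _ 0) !big_ord_recl big_ord0 addr0 /cofactor !det_mx11.
rewrite !mxE /= addn0 addn1 expr0 expr1 mul1r mulN1r mulrN.
by congr (A _ _ * A _ _ - A _ _ * A _ _); apply/val_inj.
Qed.

Lemma mxtrace_mx22 (R : comPzRingType) (A : 'M[R]_2) : \tr A = A 0 0 + A 1 1.
Proof.
rewrite /mxtrace !big_ord_recl big_ord0 addr0.
by congr (A _ _ + A _ _); apply/val_inj.
Qed.

Lemma row_free_injP (K : fieldType) m n (A : 'M[K]_(m, n)) :
  reflect (forall u : 'rV_m, u *m A = 0 -> u = 0) (row_free A).
Proof.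
apply: (iffP idP) => [Afree u uA | ]; last exact: inj_row_free.
by apply: (row_free_inj Afree); rewrite uA mul0mx.
Qed.

Lemma colinear_or_free (K : fieldType) (x y : 'rV[K]_2) : x != 0 ->
  (exists l, y = l *: x) \/ row_free (col_mx x y).
Proof.
move=> x0; have [|yfree] := boolP (y <= x)%MS; [by move/sub_rVP; left | right].
apply/row_free_injP => u; rewrite -[u]hsubmxK mul_row_col.
rewrite (mx11_scalar (lsubmx u)) (mx11_scalar (rsubmx u)) !mul_scalar_mx.
set s := lsubmx _ _ _; set t := rsubmx _ _ _ => st0.
have t0 : t = 0.
  apply: contraNeq yfree => t0; apply/sub_rVP; exists (- (t^-1 * s)).
  apply: (scalerI t0); rewrite scalerA mulrN mulrA divff // mul1r scaleNr.
  by apply/eqP; rewrite -addr_eq0 addrC st0.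
move: st0; rewrite t0 scale0r addr0 => /eqP; rewrite scaler_eq0 (negPf x0).
by rewrite orbF => /eqP->; rewrite raddf0 row_mx0.
Qed.

Section SemilinearStructure.
Variables (E : finFieldType) (q : nat) (phi : {rmorphism E -> E}).
Hypotheses (phiE : forall x, phi x = x ^+ q) (card_E : #|E| = (q ^ 4)%N).

Local Notation "A ^f" := (map_mx phi A) : ring_scope.

Lemma phi4 x : phi (phi (phi (phi x))) = x.
Proof.
rewrite -[RHS]expf_card card_E !phiE -!exprM.
by congr (_ ^+ _); ring.
Qed.

Lemma map_phi4 m n (A : 'M_(m, n)) : A^f^f^f^f = A.
Proof. by apply/matrixP=> i j; rewrite !mxE phi4. Qed.

Lemma q_gt1 : (1 < q)%N.
Proof. by have := finNzRing_gt1 E; rewrite card_E; case: q => [|[|]]. Qed.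

Lemma card_units : (#|E|.-1 = (q - 1) * (q ^ 3 + q ^ 2 + q + 1))%N.
Proof.
have := q_gt1; rewrite card_E -subn1; case: q => // k _.
by rewrite subSS subn0; apply/eqP; rewrite -(eqn_add2r 1) subnK ?expn_gt0 //;
  apply/eqP; ring.
Qed.

(* The norm to the fixed field of phi. *)
Definition cnorm x := x * phi x * phi (phi x) * phi (phi (phi x)).

Lemma cnormE x : cnorm x = x ^+ (q ^ 3 + q ^ 2 + q + 1).
Proof.
rewrite /cnorm !phiE -!exprM -[X in X * _ * _ * _]expr1 -!exprD.
by congr (_ ^+ _); ring.
Qed.

Lemma card_cnorm1 : #|[set x | cnorm x == 1]| = (q ^ 3 + q ^ 2 + q + 1)%N.
Proof.
rewrite -[RHS](@card_unity_roots E) ?card_units ?dvdn_mull //.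
by apply: eq_card => x; rewrite !inE cnormE.
Qed.

Lemma cnorm_onto c : c != 0 -> phi c = c -> exists x, cnorm x = c.
Proof.
move=> c0; rewrite phiE => cq.
have cq1 : c ^+ (q - 1) = 1.
  by apply: (mulfI c0); rewrite -exprS subn1 prednK ?(ltnW q_gt1) // cq mulr1.
have nm : ((q ^ 3 + q ^ 2 + q + 1) * (q - 1) = #|E|.-1)%N by rewrite card_units
  mulnC.
by have [x xc] := finField_root_exists nm cq1; exists x; rewrite cnormE.
Qed.

Lemma phi2_neq_id : exists x, phi (phi x) != x.
Proof.
have [z z_prim] := finField_prim_root E; exists z; apply/eqP.
rewrite !phiE -exprM => zq.
have q1 := q_gt1.
have z0 : z != 0.
  apply/eqP=> z0; have := prim_expr_order z_prim; rewrite z0 expr0n.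
  by rewrite eqn0Ngt (prim_order_gt0 z_prim) => /eqP; rewrite eq_sym oner_eq0.
have : z ^+ (q * q).-1 == 1.
  apply/eqP/(mulfI z0); rewrite -exprS prednK ?zq ?mulr1 //.
  by rewrite muln_gt0 !(ltnW q1).
have q2 : (1 < q * q)%N by rewrite (leq_trans q1) // leq_pmull ?(ltnW q1).
rewrite -(prim_order_dvd z_prim) => /dvdn_leq; rewrite -!subn1 subn_gt0 q2.
move=> /(_ isT); rewrite leq_sub2rE ?(ltnW q2) // card_E.
by rewrite (leq_exp2l 4 2).
Qed.

Lemma linearized_eq0 (v : 'rV[E]_4) :
  (forall x, \sum_i v 0 i * x ^+ (q ^ i) = 0) -> v = 0.
Proof.
move=> v0; pose p : {poly E} := \sum_(i < 4) v 0 i *: 'X^(q ^ i).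
have q1 := q_gt1.
have size_p : (size p <= (q ^ 3).+1)%N.
  apply/(leq_trans (size_sum _ _ _))/bigmax_leqP => i _.
  rewrite (leq_trans (size_scale_leq _ _)) // size_polyXn ltnS leq_exp2l //.
  by rewrite -ltnS.
have p0 : p = 0.
  apply/eqP; apply: contraLR size_p => p0; rewrite -ltnNge.
  have := @max_poly_roots _ p (enum E) p0 _ (enum_uniq E).
  rewrite -cardE card_E => lt_p.
  rewrite (leq_ltn_trans _ (lt_p _)) ?ltn_exp2l //.
  apply/allP=> x _; rewrite /root horner_sum; apply/eqP.
  by rewrite -[RHS](v0 x); apply: eq_bigr => i _; rewrite hornerZ hornerXn.
apply/rowP=> i; rewrite mxE -(coef0 E (q ^ i)) -p0 coef_sum (bigD1 i) //=.
rewrite coefZ coefXn eqxx mulr1 big1 ?addr0 // => j ji.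
rewrite coefZ coefXn eqn_exp2l //; case: eqP => [ij|]; last by rewrite mulr0.
by rewrite (val_inj ij) eqxx in ji.
Qed.

End SemilinearStructure.

(** * Semilinear pairs on a plane *)

Lemma eigen_parallel (K : fieldType) (A : 'M[K]_2) a (x z : 'rV_2) :
    x != 0 -> x *m A = a *: x -> z *m A = a *: z ->
  (exists l, z = l *: x) \/ A = a%:M.
Proof.
move=> x0 xA zA; have [|xz_free] := colinear_or_free z x0; [by left | right].
apply: (row_full_inj (xz_free : row_full _)).
by rewrite mul_mx_scalar mul_col_mx xA zA scale_col_mx.
Qed.

Section SemilinearPair.
Variables (E : finFieldType) (q : nat) (phi : {rmorphism E -> E}).
Hypotheses (phiE : forall x, phi x = x ^+ q) (card_E : #|E| = (q ^ 4)%N).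

Local Notation "A ^f" := (map_mx phi A) : ring_scope.
Local Notation phi4 := (phi4 phiE card_E).
Local Notation map_phi4 := (map_phi4 phiE card_E).

Lemma linearized_neq0 w1 w2 w3 :
  exists m, m + phi m * w1 + phi (phi m) * w2 + phi (phi (phi m)) * w3 != 0.
Proof.
apply/existsP; rewrite -[[exists _, _]]negbK negb_exists; apply/negP.
move=> /forallP y0; pose v : 'rV[E]_4 := \row_i nth 0 [:: 1; w1; w2; w3] i.
have /rowP/(_ 0) : v = 0.
  apply: (linearized_eq0 card_E) => m; have /negPn/eqP y0m := y0 m;
    rewrite -[RHS]y0m.
  rewrite !big_ord_recl big_ord0 !mxE /= /bump /= !add1n expn0 expn1 expr1.
  rewrite !phiE -!exprM (_ : (q ^ 2 = q * q)%N); last by ring.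
  by rewrite (_ : (q ^ 3 = q * q * q)%N); ring.
by rewrite !mxE /= => /eqP; rewrite oner_eq0.
Qed.

Variables Th H : 'M[E]_2.
Hypothesis ThH1 : Th^f *m Th + H^f *m H^f^f = 0.
Hypothesis ThH2 : Th^f *m H + H^f *m Th^f^f = 1%:M.

(* In the coordinates of a basis B of the code these are the two components of
   sg (x *m B) = theta x *m B + sg (sg (eta x *m B)); see mrd_generator. *)
Definition theta (x : 'rV[E]_2) : 'rV[E]_2 := x^f *m Th.
Definition eta (x : 'rV[E]_2) : 'rV[E]_2 := x^f^f^f *m H^f^f.
Let A := Th^f^f^f *m H^f^f.

Lemma one_minus_A : H^f^f^f *m Th = 1%:M - A.
Proof.
have := congr1 (fun M => M^f^f) ThH2.
rewrite !(map_mxD, map_mxM, map_mx1) /= map_phi4 => <-.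
by rewrite addrC addKr.
Qed.

Lemma thetaZ a x : theta (a *: x) = phi a *: theta x.
Proof. by rewrite /theta map_mxZ -scalemxAl. Qed.

Lemma etaZ a x : eta (a *: x) = phi (phi (phi a)) *: eta x.
Proof. by rewrite /eta !map_mxZ -scalemxAl. Qed.

Lemma thetaN x : theta (- x) = - theta x.
Proof. by rewrite /theta map_mxN mulNmx. Qed.

Lemma thetaD x y : theta (x + y) = theta x + theta y.
Proof. by rewrite /theta map_mxD mulmxDl. Qed.

Lemma eta_theta x : eta (theta x) = x *m A.
Proof. by rewrite /eta /theta !map_mxM /= map_phi4 mulmxA. Qed.

Lemma theta_eta x : theta (eta x) = x - x *m A.
Proof.
rewrite /eta /theta !map_mxM /= map_phi4 -mulmxA one_minus_A.
by rewrite mulmxBr mulmx1.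
Qed.

Lemma theta_theta x : theta (theta x) = - eta (eta x).
Proof.
rewrite /eta /theta !map_mxM /= !map_phi4 -!mulmxA -mulmxN; congr (_ *m _).
by apply/eqP; rewrite -addr_eq0 ThH1.
Qed.

Lemma theta_eigen a x : x *m A = a *: x ->
  theta x *m A = phi (1 - a) *: theta x.
Proof.
move=> xA; have := theta_eta (theta x); rewrite eta_theta xA thetaZ.
by move/eqP; rewrite eq_sym subr_eq addrC -subr_eq => /eqP<-;
  rewrite rmorphB rmorph1 scalerBl scale1r.
Qed.

Lemma eta_eigen a x : x *m A = a *: x ->
  eta x *m A = phi (phi (phi (1 - a))) *: eta x.
Proof. by move=> xA; rewrite -eta_theta theta_eta xA -etaZ scalerBl scale1r.
  Qed.

Lemma trace_A : phi (\tr A) = 2 - \tr A.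
Proof.
rewrite -trace_map_mx map_mxM /= map_phi4 mxtrace_mulC one_minus_A.
by rewrite raddfB /= mxtrace1.
Qed.

Lemma det_A : phi (\det A) = 1 - \tr A + \det A.
Proof.
rewrite -det_map_mx map_mxM /= map_phi4 det_mulmx mulrC -det_mulmx one_minus_A.
by rewrite !det_mx22 mxtrace_mx22 !mxE /=; ring.
Qed.

Lemma charpoly_A a : \det (A - a%:M) = a ^+ 2 - \tr A * a + \det A.
Proof. by rewrite !det_mx22 mxtrace_mx22 !mxE /=; ring. Qed.

Lemma A_has_eigenvalue : [pchar E].-nat q ->
  exists a, a ^+ 2 - \tr A * a + \det A = 0.
Proof.
move=> q_pchar; apply: (@quadratic_root E (q ^ 2)).
- by rewrite card_E; ring.
- by rewrite pnatX q_pchar.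
- by rewrite expnS expn1 exprM -!phiE trace_A rmorphB rmorph_nat trace_A; ring.
rewrite expnS expn1 exprM -!phiE det_A rmorphD rmorphB rmorph1 trace_A det_A.
by ring.
Qed.

Lemma A_eigenvector a : a ^+ 2 - \tr A * a + \det A = 0 ->
  exists2 x : 'rV_2, x != 0 & x *m A = a *: x.
Proof.
rewrite -charpoly_A => /eqP/det0P[x x0 xA]; exists x => //.
by apply/eqP; rewrite -subr_eq0 -mul_mx_scalar -mulmxBr xA.
Qed.

Lemma A_twisted_root a : a ^+ 2 - \tr A * a + \det A = 0 ->
  phi (1 - a) ^+ 2 - \tr A * phi (1 - a) + \det A = 0.
Proof.
move=> rt; have tA : \tr A = phi (2 - \tr A).
  by rewrite rmorphB rmorph_nat trace_A; ring.
have dA : \det A = phi (1 - \tr A + \det A).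
  by rewrite rmorphD rmorphB rmorph1 trace_A det_A; ring.
rewrite {1}tA {1}dA -rmorphXn -rmorphM -rmorphB -rmorphD -[RHS](rmorph0 phi).
by congr (phi _); rewrite -[RHS]rt; ring.
Qed.

Hypothesis no_common_eigenvector : forall (x : 'rV_2) a b,
  x != 0 -> theta x = a *: x -> eta x = b *: x -> False.

(* If A is such a scalar a then theta^4 is the scalar c = - a (1 - a), which lies in
   the fixed field of phi; as c is a norm, some multiple of theta has fourth power 1,
   and it fixes a nonzero vector as in Hilbert 90. *)
Lemma A_not_fixed_scalar a : phi a = 1 - a -> A != a%:M.
Proof.
move=> phia; apply/eqP=> Aa.
have a0 : a != 0.
  apply/eqP=> a0; move/eqP: phia; rewrite a0 rmorph0 subr0 eq_sym.
  by rewrite oner_eq0.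
have a10 : 1 - a != 0 by rewrite -phia fmorph_eq0.
have phiphia : phi (1 - a) = a by rewrite rmorphB rmorph1 phia; ring.
have eth x : eta (theta x) = a *: x by rewrite eta_theta Aa mul_mx_scalar.
have the x : theta (eta x) = (1 - a) *: x.
  by rewrite theta_eta Aa mul_mx_scalar scalerBl scale1r.
pose c := - ((1 - a) * a).
have th4 x : theta (theta (theta (theta x))) = c *: x.
  rewrite [theta (theta (theta x))]theta_theta eth thetaN the scalerA.
  by rewrite -scaleNr.
have c0 : c != 0 by rewrite oppr_eq0 mulf_neq0.
have phic : phi c = c by rewrite rmorphN rmorphM phiphia phia mulrC.
have [l lc] : exists l, cnorm phi l = c^-1.
  by apply: (cnorm_onto phiE card_E); rewrite ?invr_eq0 // fmorphV phic.
have l0 : l != 0.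
  apply: contra_eq_neq lc => ->; rewrite /cnorm !mul0r eq_sym invr_eq0.
  exact: c0.
pose x : 'rV[E]_2 := const_mx 1.
pose w1 := l *: theta x; pose w2 := l *: theta w1; pose w3 := l *: theta w2.
have w4 : l *: theta w3 = x.
  rewrite /w3 /w2 /w1 !thetaZ th4 !scalerA.
  rewrite (_ : _ * c = cnorm phi l * c); last by rewrite /cnorm; ring.
  by rewrite lc mulVf // scale1r.
pose y m := m *: x + phi m *: w1 + phi (phi m) *: w2 + phi (phi (phi m)) *: w3.
have thy m : theta (y m) = l^-1 *: y m.
  apply: (scalerI l0); rewrite scalerA divff // scale1r.
  have swap k u : l *: (k *: u) = k *: (l *: u) by rewrite !scalerA mulrC.
  rewrite /y !thetaD !(thetaZ _ x, thetaZ _ w1, thetaZ _ w2, thetaZ _ w3).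
  rewrite !scalerDr !swap w4 phi4 -/w1 -/w2 -/w3 addrC !addrA.
  by [].
have [m ym] := linearized_neq0 (w1 0 0) (w2 0 0) (w3 0 0).
have ym0 : y m != 0.
  apply: contra_neq ym => ym0; have := congr1 (fun M : 'rV_2 => M 0 0) ym0.
  by rewrite /y; move: (w1) (w2) (w3) => u1 u2 u3; rewrite !mxE mulr1.
apply: (no_common_eigenvector (b := phi (phi (phi l)) * a) ym0 (thy m)).
have := eth (y m); rewrite thy etaZ !fmorphV -scalerA => <-.
by rewrite scalerA divff ?scale1r // !fmorph_eq0.
Qed.

Lemma eigenvectors_swapped : [pchar E].-nat q ->
  exists (x y : 'rV_2) (a b : E),
    [/\ x != 0, y != 0, a != 0, x *m A = a *: x & y *m A = b *: y] /\
    [/\ a != b, phi a = 1 - b & phi b = 1 - a].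
Proof.
move=> q_pchar; have [a aroot] := A_has_eigenvalue q_pchar.
have broot := A_twisted_root aroot; set b := phi (1 - a) in broot.
have [x x0 xA] := A_eigenvector aroot.
have [y y0 yA] := A_eigenvector broot.
have ab : a != b.
  apply/eqP=> ab; have phia : phi a = 1 - a.
    by rewrite [in RHS]ab /b rmorphB rmorph1; ring.
  have fx := theta_eigen xA; rewrite -/b -ab in fx.
  have gx := eta_eigen xA; rewrite -/b -ab phia -/b -ab in gx.
  have nA := negP (A_not_fixed_scalar phia).
  case: (eigen_parallel x0 xA fx) => [[l thx]|/eqP//].
  case: (eigen_parallel x0 xA gx) => [[m etx]|/eqP//].
  exact: no_common_eigenvector x0 thx etx.
have phib : phi b = 1 - a.
  have croot := A_twisted_root broot; set c := phi (1 - b) in croot.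
  have : (c - a) * (c - b) = 0.
    have : (b - a) * (a + b - \tr A) = 0.
      by have := congr2 (fun u v => u - v) broot aroot; rewrite subrr => <-;
        ring.
    move/eqP; rewrite mulf_eq0 subr_eq0 eq_sym (negPf ab) /= subr_eq0 =>
      /eqP tA.
    have := congr2 (fun u v => u - v) croot aroot; rewrite subrr => <-.
    by rewrite -tA; ring.
  move/eqP; rewrite mulf_eq0 !subr_eq0 => /orP[/eqP ca|/eqP cb].
    by rewrite -ca /c rmorphB rmorph1; ring.
  move: ab; rewrite -(inj_eq (subrI 1)) -(inj_eq (fmorph_inj phi)).
  by rewrite -/b -/c cb eqxx.
have phia : phi a = 1 - b by rewrite /b rmorphB rmorph1; ring.
have [a0|a0] := eqVneq a 0; last by exists x, y, a, b; split; split.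
exists y, x, b, a; split; split => //; last by rewrite eq_sym.
by rewrite eq_sym -a0.
Qed.

Lemma swapped_pair_exists : [pchar E].-nat q ->
  exists (x y : 'rV_2) (al be : E),
    [/\ row_free (col_mx x y), theta x = al *: y & eta x = be *: y] /\
    [/\ al != 0, cnorm phi (be / al) != 1
      & al * phi (phi al) != be * phi (phi be)].
Proof.
move=> q_pchar; have [x [y [a [b]]]] := eigenvectors_swapped q_pchar.
move=> [[x0 y0 a0 xA yA] [ab phia phib]].
have phi1a : phi (1 - a) = b by rewrite rmorphB rmorph1 phia; ring.
have phi1b : phi (1 - b) = a by rewrite rmorphB rmorph1 phib; ring.
have cancel c d (z : 'rV[E]_2) : z != 0 -> c *: z = d *: z -> c = d.
  move=> z0 /eqP; rewrite -subr_eq0 -scalerBl scaler_eq0 (negPf z0) orbF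
    subr_eq0.
  by move/eqP.
have An c : A != c%:M.
  apply: contraNneq ab => Ac; rewrite Ac mul_mx_scalar in xA.
  rewrite Ac mul_mx_scalar in yA.
  by rewrite -(cancel _ _ _ x0 xA) -(cancel _ _ _ y0 yA).
have ontoy z : z *m A = b *: z -> exists l, z = l *: y.
  move=> zA; case: (eigen_parallel y0 yA zA) => // /eqP.
  by rewrite (negPf (An b)).
have ontox z : z *m A = a *: z -> exists l, z = l *: x.
  move=> zA; case: (eigen_parallel x0 xA zA) => // /eqP.
  by rewrite (negPf (An a)).
have [|al thx] := ontoy (theta x); first by rewrite (theta_eigen xA) phi1a.
have [|be etx] := ontoy (eta x).
  by rewrite (eta_eigen xA) phi1a phib phi1a.
have [|ga thy] := ontox (theta y); first by rewrite (theta_eigen yA) phi1b.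
have [|de ety] := ontox (eta y).
  by rewrite (eta_eigen yA) phi1b phia phi1b.
have aE : phi (phi (phi al)) * de = a.
  by apply: (cancel _ _ x) => //; rewrite -xA -eta_theta thx etaZ ety scalerA.
have bE : phi be * ga = 1 - a.
  apply: (cancel _ _ x) => //; rewrite scalerBl scale1r -xA -theta_eta etx.
  by rewrite thetaZ thy scalerA.
have th2 : phi al * ga = - (phi (phi (phi be)) * de).
  apply: (cancel _ _ x) => //; rewrite scaleNr -!scalerA -thy -ety.
  by rewrite -thetaZ -etaZ -thx -etx theta_theta.
have al0 : al != 0 by apply: contra_neq a0 => al0;
  rewrite -aE al0 !rmorph0 mul0r.
have key : phi al * phi (phi (phi al)) * (1 - a)
           = - (phi be * phi (phi (phi be)) * a).
  rewrite -bE -aE; move: th2; clear.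
  move: (phi al) (phi (phi (phi al))) (phi be) (phi (phi (phi be))) =>
    u u3 v v3 th2.
  by transitivity ((u * ga) * (u3 * v)); [ring | rewrite th2; ring].
have phia0 : phi a != 0 by rewrite fmorph_eq0.
have r_eq : phi (be / al) * phi (phi (phi (be / al))) = - ((1 - a) / a).
  have k1 : phi al != 0 by rewrite fmorph_eq0.
  have k3 : phi (phi (phi al)) != 0 by rewrite !fmorph_eq0.
  rewrite !fmorph_div; move: key k1 k3; clear -a0.
  move: (phi al) (phi (phi (phi al))) (phi be) (phi (phi (phi be))) =>
    u u3 v v3.
  move=> key u0 u30; rewrite mulf_div; apply/eqP.
  rewrite -mulNr eqr_div ?mulf_neq0 //; apply/eqP.
  by rewrite -[LHS]opprK -key; ring.
have w_eq : be / al * phi (phi (be / al)) = - (b / (1 - b)).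
  have := congr1 phi r_eq; rewrite rmorphM /= phi4 mulrC => ->.
  by rewrite rmorphN fmorph_div phi1a phia.
exists x, y, al, be; split; split=> //.
- have [[l yx]|//] := colinear_or_free y x0; case/eqP: ab.
  by apply: (cancel _ _ _ y0); rewrite -yA yx -scalemxAl xA !scalerA mulrC.
- have N_eq : cnorm phi (be / al) = (1 - a) / a * (b / (1 - b)).
    rewrite -[RHS]mulrNN -r_eq -w_eq /cnorm; clear.
    by move: (be / al) => u; move: (phi (phi u)) (phi (phi (phi u))) (phi u) =>
      u2 u3 u1; ring.
  apply: contraNneq ab => N1; have N1' := etrans (esym N_eq) N1.
  have b1 : 1 - b != 0 by rewrite -phia.
  have eq0 : (1 - a) * b = a * (1 - b).
    have := congr1 (fun z => z * (a * (1 - b))) N1'; rewrite /= mul1r => <-.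
    by field; rewrite a0 b1.
  have : a - b = a * (1 - b) - (1 - a) * b by ring.
  by rewrite eq0 subrr => /eqP; rewrite subr_eq0.
rewrite -(inj_eq (fmorph_inj phi)) !rmorphM /=; apply: contra_neq a0 => al_be.
have : (1 - a) * (phi al * phi (phi (phi al))) = - a * (phi al * phi (phi (phi
  al))).
  by rewrite mulrC key al_be; ring.
move/mulIf; rewrite mulf_neq0 ?fmorph_eq0 // => /(_ isT).
by move/eqP; rewrite subr_eq addrC subrr oner_eq0.
Qed.

End SemilinearPair.

(** * Classification of the MRD codes *)

Section Codes.
Variables (E : finFieldType) (q : nat) (phi : {rmorphism E -> E}).
Hypotheses (phiE : forall x, phi x = x ^+ q) (card_E : #|E| = (q ^ 4)%N).
Hypothesis q_pchar : [pchar E].-nat q.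

Local Notation "A ^f" := (map_mx phi A) : ring_scope.
Local Notation phi4 := (phi4 phiE card_E).
Local Notation map_phi4 := (map_phi4 phiE card_E).
Local Notation N := (cnorm phi).

Variable P : 'M[E]_4.
Hypotheses (phiP : P^f = P) (P4 : P *m P *m P *m P = 1%:M).

(* Locked: otherwise rewriting with sgM or sgD unfolds a term sg M to find a
   product or a sum. *)
Fact sg_key : unit. Proof. by []. Qed.
Definition sg m (M : 'M[E]_(m, 4)) := locked_with sg_key (M^f *m P).

Lemma sgE m (M : 'M_(m, 4)) : sg M = M^f *m P.
Proof. exact: locked_withE. Qed.

(* The rows are v, sg v, .., so that v has rank at least k iff orbmx k v is
   row-free (row_free_orbmx). *)
Definition orbmx k (v : 'rV[E]_4) : 'M[E]_(k, 4) := \matrix_(i < k) iter i (@sg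
  1) v.

Lemma sgM m n (M : 'M_(m, n)) (B : 'M_(n, 4)) : sg (M *m B) = M^f *m sg B.
Proof. by rewrite !sgE map_mxM mulmxA. Qed.

Lemma sgZ m a (M : 'M_(m, 4)) : sg (a *: M) = phi a *: sg M.
Proof. by rewrite !sgE map_mxZ scalemxAl. Qed.

Lemma sgD m (M B : 'M_(m, 4)) : sg (M + B) = sg M + sg B.
Proof. by rewrite !sgE map_mxD mulmxDl. Qed.

Lemma sg4 m (M : 'M_(m, 4)) : sg (sg (sg (sg M))) = M.
Proof.
have P4r := P4; rewrite -!mulmxA in P4r.
by rewrite !sgE !map_mxM /= !phiP map_phi4 -!mulmxA P4r mulmx1.
Qed.

Lemma orbmxP k v : reflect
  (forall c : 'I_k -> E, \sum_i c i *: iter i (@sg 1) v = 0 -> forall i, c i =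
    0)
  (row_free (orbmx k v)).
Proof.
apply: (iffP (row_free_injP _)) => [freev c c0 i | freev u].
  have /rowP/(_ i) : \row_i c i = 0; last by rewrite !mxE.
  apply: freev; rewrite mulmx_sum_row -[RHS]c0.
  by apply: eq_bigr => j _; rewrite mxE rowK.
rewrite mulmx_sum_row => u0; apply/rowP=> i; rewrite mxE; apply: freev i.
by rewrite -[RHS]u0; apply: eq_bigr => j _; rewrite rowK.
Qed.

Lemma orbmx3P v : reflect
  (forall c0 c1 c2, c0 *: v + c1 *: sg v + c2 *: sg (sg v) = 0 ->
     [/\ c0 = 0, c1 = 0 & c2 = 0])
  (row_free (orbmx 3 v)).
Proof.
apply: (iffP (orbmxP 3 v)) => [freev c0 c1 c2 c_eq0 | freev c].
  have h := freev (fun i : 'I_3 => nth 0 [:: c0; c1; c2] i) _.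
  rewrite !big_ord_recl big_ord0 /= addr0 addrA in h.
  by split; [apply: (h c_eq0 0) | apply: (h c_eq0 1) | apply: (h c_eq0 2)].
rewrite !big_ord_recl big_ord0 /= addr0 addrA => /freev[c0 c1 c2] i.
case: i => [[|[|[|//]]] lti]; [rewrite -[RHS]c0 | rewrite -[RHS]c1 | rewrite
  -[RHS]c2];
  by congr c; apply: val_inj.
Qed.

Lemma orbmx4P v : reflect
  (forall c0 c1 c2 c3, c0 *: v + c1 *: sg v + c2 *: sg (sg v) + c3 *: sg (sg
    (sg v)) = 0 ->
     [/\ c0 = 0, c1 = 0, c2 = 0 & c3 = 0])
  (row_free (orbmx 4 v)).
Proof.
apply: (iffP (orbmxP 4 v)) => [freev c0 c1 c2 c3 c_eq0 | freev c].
  have h := freev (fun i : 'I_4 => nth 0 [:: c0; c1; c2; c3] i) _.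
  rewrite !big_ord_recl big_ord0 /= addr0 !addrA in h.
  by split; [apply: (h c_eq0 0) | apply: (h c_eq0 1) | apply: (h c_eq0 2) |
    apply: (h c_eq0 3)].
rewrite !big_ord_recl big_ord0 /= addr0 !addrA => /freev[c0 c1 c2 c3] i.
case: i => [[|[|[|[|//]]]] lti]; [rewrite -[RHS]c0 | rewrite -[RHS]c1 | rewrite
  -[RHS]c2| rewrite -[RHS]c3];
  by congr c; apply: val_inj.
Qed.

Section Classification.
Variable B : 'M[E]_(2, 4).
Hypotheses (Bfree : row_free B)
  (Bmrd : forall x : 'rV_2, x != 0 -> row_free (orbmx 3 (x *m B))).

Lemma mrd_sg2_disjoint (x y : 'rV_2) : sg (sg (x *m B)) = y *m B -> x = 0.
Proof.
move=> xy; have yx : sg (sg (y *m B)) = x *m B by rewrite -xy sg4.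
have fix0 l : l *: x + phi (phi l) *: y = 0.
  apply/eqP/negPn/negP => /Bmrd/orbmx3P/(_ (-1) 0 1).
  rewrite scaleN1r scale0r addr0 scale1r.
  rewrite mulmxDl -!scalemxAl !sgD !sgZ xy yx phi4 [_ + phi _ *: _]addrC addNr.
  by case=> // _ _ /eqP; rewrite oner_eq0.
have y_x : y = - x.
  by apply/eqP; rewrite -addr_eq0 addrC; have := fix0 1;
    rewrite !rmorph1 !scale1r => ->.
have [l ll] := phi2_neq_id phiE card_E.
have /eqP := fix0 l; rewrite y_x scalerN -scalerBl scaler_eq0 subr_eq0 eq_sym.
by rewrite (negPf ll) => /eqP.
Qed.

Lemma mrd_sg2_complement : row_free (col_mx B (sg (sg B))).
Proof.
apply/row_free_injP => u; rewrite -[u]hsubmxK mul_row_col.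
move: (lsubmx u) (rsubmx u) => u1 u2 /eqP; rewrite addrC addr_eq0 => /eqP u12.
have u20 : u2^f^f = 0.
  apply: (@mrd_sg2_disjoint _ (- u1)).
  by rewrite !sgM map_phi4 u12 mulNmx.
have {}u20 : u2 = 0 by rewrite -[u2]map_phi4 u20 !map_mx0.
move: u12; rewrite u20 mul0mx => /esym/eqP; rewrite oppr_eq0 => /eqP u10.
by rewrite (row_free_injP _ Bfree _ u10) row_mx0.
Qed.

Lemma mrd_generator : exists g b,
  [/\ row_free (orbmx 4 g), N b != 1, (g <= B)%MS
    & ((sg g + b *: sg (sg (sg g)))%R <= B)%MS].
Proof.
pose BB := col_mx B (sg (sg B)).
have BBunit : BB \in unitmx by rewrite -row_free_unit mrd_sg2_complement.
pose TH := sg B *m invmx BB; pose Th := lsubmx TH; pose H := rsubmx TH.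
have sgB : sg B = Th *m B + H *m sg (sg B).
  by rewrite -mul_row_col hsubmxK /TH -mulmxA mulVmx // mulmx1.
have uniq m (x1 x2 y1 y2 : 'M_(m, 2)) :
    x1 *m B + x2 *m sg (sg B) = y1 *m B + y2 *m sg (sg B) -> x1 = y1 /\ x2 = y2.
  rewrite -!mul_row_col => /(row_free_inj mrd_sg2_complement).
  exact: eq_row_mx.
have sg3B : sg (sg (sg B)) = H^f^f *m B + Th^f^f *m sg (sg B).
  by rewrite {1}sgB !sgD !sgM sg4 addrC.
have [ThH1 ThH2] : Th^f *m Th + H^f *m H^f^f = 0 /\ Th^f *m H + H^f *m Th^f^f =
  1%:M.
  apply: uniq; rewrite mul0mx add0r mul1mx !mulmxDl -!mulmxA addrACA -!mulmxDr.
  by rewrite -sgB -sg3B -!sgM -sgD -sgB.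
have no_common (x : 'rV_2) a b : x != 0 -> theta phi Th x = a *: x ->
    eta phi H x = b *: x -> False.
  move=> x0 thx etx; have /orbmx3P/(_ a (-1) (phi (phi b))) := Bmrd x0.
  case; last by move=> _ /eqP; rewrite oppr_eq0 oner_eq0.
  rewrite [in X in _ + X + _]sgM {1}sgB mulmxDr !mulmxA scaleN1r.
  have -> : x^f *m H = phi (phi b) *: x^f^f.
    have := congr1 (fun M => M^f^f) etx; rewrite /eta !map_mxM !map_mxZ /=.
    by rewrite !map_phi4 => ->.
  have -> : x^f *m Th = a *: x by [].
  rewrite -!scalemxAl !sgM; move: (a *: _) (phi _ *: _) => u v.
  by rewrite opprD addrA subrr add0r addNr.
have := swapped_pair_exists phiE card_E ThH1 ThH2 no_common q_pchar.
move=> [x [y [al [be [[xy_free thx etx] [al0 Nba albe]]]]]].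
have H_x : x^f *m H = phi (phi be) *: y^f^f.
  have := congr1 (fun M => M^f^f) etx; rewrite /eta !map_mxM !map_mxZ /=.
  by rewrite !map_phi4.
have sg_x : sg (x *m B) = al *: (y *m B) + phi (phi be) *: sg (sg (y *m B)).
  by rewrite sgM sgB mulmxDr !mulmxA H_x -/(theta phi Th x) thx -!scalemxAl
    !sgM.
have sg3_x : sg (sg (sg (x *m B)))
    = be *: (y *m B) + phi (phi al) *: sg (sg (y *m B)).
  by rewrite sg_x !sgD !sgZ sg4 phi4 addrC.
have sg2E (z : 'rV_2) : sg (sg (z *m B)) = z^f^f *m sg (sg B) by rewrite !sgM.
have xy_indep s t : s *: x + t *: y = 0 -> s = 0 /\ t = 0.
  move=> st0; have : row_mx s%:M t%:M = 0 :> 'rV_(1 + 1).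
    by apply: (row_free_injP _ xy_free); rewrite mul_row_col !mul_scalar_mx.
  rewrite -row_mx0 => /eq_row_mx[/matrixP/(_ 0 0) + /matrixP/(_ 0 0)].
  by rewrite !mxE !mulr1n.
exists (x *m B), (- (phi (phi (be / al)))); split.
- apply/orbmx4P => c0 c1 c2 c3; rewrite sg3_x [sg (sg (x *m B))]sg2E sg_x !sg2E
  => c_eq0.
  have [] := @uniq 1 (c0 *: x + (c1 * al + c3 * be) *: y)
    (c2 *: x^f^f + (c1 * phi (phi be) + c3 * phi (phi al)) *: y^f^f) 0 0.
    rewrite !mul0mx add0r !mulmxDl -!scalemxAl -[RHS]c_eq0.
    move: (x *m B) (y *m B) (x^f^f *m _) (y^f^f *m _) => X Y X' Y'.
    by apply/rowP=> i; rewrite !mxE; ring.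
  move=> /xy_indep[-> eq1] /(congr1 (fun M => M^f^f)).
  rewrite !map_mxD !map_mxZ !map_mx0 /= !map_phi4 =>
    /xy_indep[/eqP c20 /eqP eq2].
  move: c20 eq2; rewrite !fmorph_eq0 => /eqP-> /eqP eq2.
  have D0 : al * phi (phi al) - be * phi (phi be) != 0 by rewrite subr_eq0.
  split=> //; apply: (mulIf D0); rewrite mul0r.
    transitivity ((c1 * al + c3 * be) * phi (phi al)
                  - (c1 * phi (phi be) + c3 * phi (phi al)) * be).
      by move: (phi (phi _)) (phi (phi _)) => u v; ring.
    by rewrite eq1 eq2 !mul0r subrr.
  transitivity ((c1 * phi (phi be) + c3 * phi (phi al)) * al
                - (c1 * al + c3 * be) * phi (phi be)).
    by move: (phi (phi _)) (phi (phi _)) => u v; ring.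
  by rewrite eq1 eq2 !mul0r subrr.
- suff -> : N (- phi (phi (be / al))) = N (be / al) by [].
  rewrite /cnorm !rmorphN /= !phi4.
  move: (be / al) => u; move: (phi u) (phi (phi u)) (phi (phi (phi u))) => *;
    ring.
- exact: submxMl.
set w := phi (phi (be / al)).
have wE : phi (phi be) = w * phi (phi al).
  by rewrite /w !fmorph_div divfK ?fmorph_eq0.
have -> : sg (x *m B) + - w *: sg (sg (sg (x *m B))) = (al - w * be) *: y *m B.
  rewrite sg3_x sg_x wE -scalemxAl; move: (y *m B) (sg (sg _)) => Y Y'.
  by apply/rowP=> i; rewrite !mxE; ring.
exact: submxMl.
Qed.
End Classification.
End Codes.

(** * The codes of the family and their parameters *)

Section Family.
Variables (E : finFieldType) (q : nat) (phi : {rmorphism E -> E}).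
Hypotheses (phiE : forall x, phi x = x ^+ q) (card_E : #|E| = (q ^ 4)%N).

Local Notation phi4 := (phi4 phiE card_E).
Local Notation N := (cnorm phi).

Variable P : 'M[E]_4.
Hypotheses (phiP : map_mx phi P = P) (P4 : P *m P *m P *m P = 1%:M).
Local Notation sg := (@sg E phi P 1).
Local Notation orbmx := (orbmx phi P).
Local Notation sg4 := (sg4 phiE card_E phiP P4).
Local Notation V := 'rV[E]_4.

Definition partner g b : V := sg g + b *: sg (sg (sg g)).
Definition code g b := col_mx g (partner g b).

Lemma cnormM x y : N (x * y) = N x * N y.
Proof.
rewrite /cnorm !rmorphM /=; move: (phi x) (phi y) => x1 y1.
by move: (phi x1) (phi y1) => x2 y2; move: (phi x2) (phi y2) => x3 y3; ring.
Qed.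

Lemma cnorm0 : N 0 = 0.
Proof. by rewrite /cnorm !mul0r. Qed.

Lemma cnorm_phi x : N (phi x) = N x.
Proof. by rewrite /cnorm phi4; ring. Qed.

Lemma cnorm_eq0 x : (N x == 0) = (x == 0).
Proof. by rewrite /cnorm !mulf_eq0 !fmorph_eq0 !orbb. Qed.

Lemma cnormV x : N x^-1 = (N x)^-1.
Proof. by rewrite /cnorm !fmorphV !invfM. Qed.

Lemma cnormN x : N (- x) = N x.
Proof.
rewrite /cnorm !rmorphN /=; move: (phi x) => x1.
by move: (phi x1) => x2; move: (phi x2) => x3; ring.
Qed.

Lemma phi2_norm_neq1 b : N b != 1 -> b * phi (phi b) != 1.
Proof.
apply: contra_neq => b1; have : phi (b * phi (phi b)) = 1 by rewrite b1 rmorph1.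
rewrite rmorphM /= => b2; rewrite -[RHS]mulr1 -{1}b1 -b2 /cnorm.
by move: (phi b) => x1; move: (phi x1) => x2; move: (phi x2) => x3; ring.
Qed.

Lemma iter_sgZ i t (v : V) : iter i sg (t *: v) = iter i phi t *: iter i sg v.
Proof. by elim: i => //= i ->; rewrite sgZ. Qed.

Lemma iter_phi_eq0 i t : (iter i phi t == 0) = (t == 0).
Proof. by elim: i => //= i IHi; rewrite fmorph_eq0. Qed.

Lemma orbmxZ k t (v : V) : t != 0 -> row_free (orbmx k v) -> row_free (orbmx k
  (t *: v)).
Proof.
move=> t0 /orbmxP freev; apply/orbmxP => c c0 i.
have := freev (fun j => c j * iter j phi t) _ i => h; apply/eqP.
have /eqP : c i * iter i phi t = 0.
  by apply: h; rewrite -[RHS]c0; apply: eq_bigr => j _;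
    rewrite iter_sgZ scalerA.
by rewrite mulf_eq0 iter_phi_eq0 (negPf t0) orbF.
Qed.

Lemma sub_code v g b :
  reflect (exists s t, v = s *: g + t *: partner g b) (v <= code g b)%MS.
Proof.
apply: (iffP submxP) => [[D ->]|[s [t ->]]].
  exists (lsubmx D 0 0), (rsubmx D 0 0).
  rewrite -{1}[D]hsubmxK mul_row_col.
  by rewrite {1}[lsubmx D]mx11_scalar {1}[rsubmx D]mx11_scalar !mul_scalar_mx.
by exists (row_mx s%:M t%:M); rewrite mul_row_col !mul_scalar_mx.
Qed.

Section FullRank.
Variable g : V.
Hypothesis gfree : row_free (orbmx 4 g).

Lemma sg_indep c0 c1 c2 c3 :
    c0 *: g + c1 *: sg g + c2 *: sg (sg g) + c3 *: sg (sg (sg g)) = 0 ->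
  [/\ c0 = 0, c1 = 0, c2 = 0 & c3 = 0].
Proof. by move: c0 c1 c2 c3; apply/orbmx4P. Qed.

Lemma sg_partner b : sg (partner g b) = sg (sg g) + phi b *: g.
Proof. by rewrite sgD sgZ sg4. Qed.

Lemma code_free b : row_free (code g b).
Proof.
apply/row_free_injP => u; rewrite -[u]hsubmxK mul_row_col.
rewrite [lsubmx u]mx11_scalar [rsubmx u]mx11_scalar !mul_scalar_mx.
move: (lsubmx u 0 0) (rsubmx u 0 0) => s t u0.
have [|-> -> _ _] := @sg_indep s t 0 (t * b); last by rewrite !raddf0 row_mx0.
rewrite -[RHS]u0 /partner; move: (sg g) (sg (sg g)) => v1 v2.
by move: (sg v2) => v3; apply/rowP=> i; rewrite !mxE; ring.
Qed.

Lemma code_mrd b v : N b != 1 -> (v <= code g b)%MS -> v != 0 -> row_free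
  (orbmx 3 v).
Proof.
move=> Nb /sub_code[s [t ->]] v0.
have [t0|t0] := eqVneq t 0.
  move: v0; rewrite t0 scale0r addr0 scaler_eq0 negb_or => /andP[s0 _].
  apply: orbmxZ => //; apply/orbmx3P => c0 c1 c2 c_eq0.
  by have [|-> -> -> _] := @sg_indep c0 c1 c2 0; rewrite // scale0r addr0.
have -> : s *: g + t *: partner g b = t *: (t^-1 * s *: g + partner g b).
  by rewrite [RHS]scalerDr scalerA mulrA divff // mul1r.
move: (t^-1 * s) => r; apply: orbmxZ => //; apply/orbmx3P => c0 c1 c2.
rewrite sgD sgZ sg_partner !sgD !sgZ => c_eq0.
have [|e0 e1 e2 e3] := @sg_indep (c0 * r + c1 * phi b) (c0 + c1 * phi r + c2 *
  phi (phi b))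
  (c1 + c2 * phi (phi r)) (c0 * b + c2).
  rewrite -[RHS]c_eq0 /partner; move: (sg g) => v1; move: (sg v1) => v2;
    move: (sg v2) => v3.
  by move: (phi (phi b)) (phi (phi r)) (phi b) (phi r) => *; apply/rowP=> i;
    rewrite !mxE; ring.
have c2E : c2 = - (c0 * b) by apply/eqP; rewrite -addr_eq0 addrC e3.
have c1E : c1 = c0 * b * phi (phi r).
  by apply/eqP; rewrite -subr_eq0 -[X in _ == X]e2 c2E mulNr.
suff c00 : c0 = 0 by rewrite c1E c2E c00 !mul0r oppr0.
apply/eqP; apply: contraNT Nb => c00; apply/eqP.
have f0 : r + b * phi b * phi (phi r) = 0.
  by apply: (mulfI c00); rewrite mulr0 -[RHS]e0 c1E;
    move: (phi (phi r)) (phi b) => *; ring.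
have f1 : 1 + b * phi r * phi (phi r) - b * phi (phi b) = 0.
  apply: (mulfI c00); rewrite mulr0 -[RHS]e1 c1E c2E.
  by move: (phi (phi r)) (phi (phi b)) (phi r) => *; ring.
have [r0|r0] := eqVneq r 0.
  have : b * phi (phi b) = 1.
    move: f1; rewrite r0 rmorph0 mulr0 mul0r addr0 => /eqP.
    by rewrite subr_eq0 eq_sym => /eqP.
  by move=> b1; apply/eqP; apply: contraTT isT => /phi2_norm_neq1;
    rewrite b1 eqxx.
have r20 : phi (phi r) != 0 by rewrite !fmorph_eq0.
have bb : b * phi b = - (r / phi (phi r)).
  apply: (mulIf r20); rewrite mulNr divfK //.
  by apply/eqP; rewrite -addr_eq0 addrC f0.
have := congr1 (fun z => phi (phi z)) bb;
  rewrite !rmorphN !rmorphM /= !fmorphV phi4 => bb2.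
transitivity (b * phi b * (phi (phi b) * phi (phi (phi b))));
  first by rewrite /cnorm !mulrA.
by rewrite bb bb2 mulrNN mulf_div [X in _ / X]mulrC divff ?mulf_neq0.
Qed.

Lemma partner_orbit b : N b != 1 -> row_free (orbmx 4 (partner g b)).
Proof.
move=> Nb; apply/orbmx4P => c0 c1 c2 c3; rewrite sg_partner !sgD !sgZ.
move=> c_eq0; have [|e0 e1 e2 e3] := @sg_indep (c1 * phi b + c3)
  (c0 + c2 * phi (phi b)) (c1 + c3 * phi (phi (phi b))) (c0 * b + c2).
  rewrite -[RHS]c_eq0 sg4 /partner; move: (sg g) => v1; move: (sg v1) => v2;
    move: (sg v2) => v3.
  by move: (phi (phi (phi b))) (phi (phi b)) (phi b) => *; apply/rowP=> i;
    rewrite !mxE; ring.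
have D0 : 1 - b * phi (phi b) != 0 by rewrite subr_eq0 eq_sym phi2_norm_neq1.
have D1 : 1 - phi b * phi (phi (phi b)) != 0.
  by rewrite -rmorphM -(rmorph1 phi) -rmorphB fmorph_eq0.
have c00 : c0 = 0.
  apply: (mulIf D0); rewrite mul0r -[RHS](subrr 0) -{1}e1.
  by rewrite -(mul0r (phi (phi b))) -e3; move: (phi (phi b)) => *; ring.
have c10 : c1 = 0.
  apply: (mulIf D1); rewrite mul0r -[RHS](subrr 0) -{1}e2.
  rewrite -(mul0r (phi (phi (phi b)))) -e0.
  by move: (phi b) => *; move: (phi (phi _)) => *; ring.
by move: e0 e3; rewrite c00 c10 !mul0r !add0r => -> ->.
Qed.

(* The parameters giving the same code as (g, b): those of param1, and those of
   param2 when b != 0; see code_param. *)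
Definition param1 b s : V * E := (s *: g, b * phi s / phi (phi (phi s))).
Definition param2 b t : V * E :=
  (t *: partner g b, - (phi t / (phi (phi (phi t)) * phi (phi (phi b))))).

Lemma code_param b h c : N b != 1 -> h != 0 ->
  (h <= code g b)%MS -> (partner h c <= code g b)%MS ->
  (exists2 s, s != 0 & (h, c) = param1 b s)
  \/ b != 0 /\ exists2 t, t != 0 & (h, c) = param2 b t.
Proof.
move=> Nb h0 /sub_code[s [t hE]] /sub_code[s' [t']].
rewrite /(partner h) hE !sgD !sgZ sg_partner !sgD !sgZ sg4 => /eqP.
rewrite -subr_eq0 => /eqP c_eq0; have [|e0 e1 e2 e3] := @sg_indep
  (phi t * phi b + c * phi (phi (phi t)) - s') (phi s - t')
  (phi t + c * (phi (phi (phi t)) * phi (phi (phi b))))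
  (c * phi (phi (phi s)) - t' * b).
  rewrite -[RHS]c_eq0 /partner; move: (sg g) => v1; move: (sg v1) => v2;
    move: (sg v2) => v3.
  move: (phi (phi (phi b))) (phi (phi (phi t))) (phi (phi (phi s))) (phi b)
    (phi s) (phi t) => *.
  by apply/rowP=> i; rewrite !mxE; ring.
have t'E : t' = phi s by apply/eqP; rewrite -subr_eq0 -oppr_eq0 opprB e1.
have cs : c * phi (phi (phi s)) = b * phi s.
  by apply/eqP; rewrite -subr_eq0 [b * _]mulrC -[X in _ == X]e3 t'E.
have [t0|t0] := eqVneq t 0.
  left; exists s.
    by apply: contra_neq h0 => s0; rewrite hE s0 t0 !scale0r addr0.
  have s0 : s != 0 by apply: contra_neq h0 => s0;
    rewrite hE s0 t0 !scale0r addr0.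
  by rewrite /param1 t0 scale0r addr0 -cs mulfK // !fmorph_eq0.
right; have bphi : b != 0.
  apply: contra_neq t0 => b0; move: e2; rewrite b0 !rmorph0 !mulr0 addr0 =>
    /eqP.
  by rewrite fmorph_eq0 => /eqP.
split=> //; exists t => //; have [s0|s0] := eqVneq s 0.
  rewrite /param2 s0 scale0r add0r; congr (_, _).
  have D0 : phi (phi (phi t)) * phi (phi (phi b)) != 0 by rewrite mulf_neq0
    ?fmorph_eq0.
  by apply: (mulIf D0); rewrite mulNr divfK //; apply/eqP;
    rewrite -addr_eq0 addrC e2.
case/eqP: Nb; pose r := t / s.
have r0 : r != 0 by rewrite mulf_neq0 ?invr_eq0.
have r30 : phi (phi (phi r)) != 0 by rewrite !fmorph_eq0.
have cE : c = b * phi s / phi (phi (phi s)) by rewrite -cs mulfK // !fmorph_eq0.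
have bb : b * phi (phi (phi b)) = - (phi r / phi (phi (phi r))).
  apply: (mulIf r30); rewrite mulNr divfK //; apply/eqP; rewrite -addr_eq0.
  have k1 : phi s != 0 by rewrite fmorph_eq0.
  have k3 : phi (phi (phi s)) != 0 by rewrite !fmorph_eq0.
  rewrite -(mulrI_eq0 _ (mulfI k1)) -[X in _ == X]e2 cE /r !fmorph_div.
  by apply/eqP; field; rewrite k1 k3.
clearbody r; have := congr1 (fun z => phi (phi z)) bb;
  rewrite !rmorphN !rmorphM /= !fmorphV !phi4 => bb2.
transitivity (b * phi (phi (phi b)) * (phi (phi b) * phi b)).
  by rewrite /cnorm; move: (phi b) => x1; move: (phi x1) => x2;
    move: (phi x2) => x3; ring.
rewrite bb bb2 mulrNN mulf_div [X in _ / X]mulrC divff ?mulf_neq0 ?fmorph_eq0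
  //.
Qed.

Lemma param1_partner b s : s != 0 ->
  partner (param1 b s).1 (param1 b s).2 = phi s *: partner g b.
Proof.
move=> s0; rewrite /partner /= !sgZ scalerA divfK ?fmorph_eq0 //.
by rewrite scalerDr scalerA [b * _]mulrC.
Qed.

Lemma param2_partner b t : t != 0 -> b != 0 ->
  exists k, partner (param2 b t).1 (param2 b t).2 = k *: g.
Proof.
move=> t0 b0; exists (phi t * phi b - phi t / phi (phi (phi b))).
rewrite /(partner (_, _).1) /= !sgZ sg_partner !sgD !sgZ !sg4.
have k1 : phi (phi (phi b)) != 0 by rewrite !fmorph_eq0.
have k3 : phi (phi (phi t)) != 0 by rewrite !fmorph_eq0.
move: (sg (sg g)) (phi (phi (phi b))) (phi (phi (phi t))) (phi t) (phi b) k1 k3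
  => v x3 t3 t1 b1 k1 k3.
by apply/rowP=> i; rewrite !mxE; field; rewrite k1 k3.
Qed.

End FullRank.
End Family.

Section Counting.
Variables (E : finFieldType) (q : nat) (phi : {rmorphism E -> E}).
Hypotheses (phiE : forall x, phi x = x ^+ q) (card_E : #|E| = (q ^ 4)%N).

Local Notation N := (cnorm phi).
Variable P : 'M[E]_4.
Hypotheses (phiP : map_mx phi P = P) (P4 : P *m P *m P *m P = 1%:M).
Local Notation orbmx := (orbmx phi P).
Local Notation partner := (partner phi P).
Local Notation code := (code phi P).
Local Notation param1 := (param1 phi).
Local Notation param2 := (param2 phi P).
Local Notation V := 'rV[E]_4.

Definition full_vectors : {set V} := [set g | row_free (orbmx 4 g)].
Definition params : {set V * E} := setX full_vectors [set b | N b != 1].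
Definition code_set (p : V * E) : {set V} := [set v | (v <= code p.1 p.2)%MS].

Lemma paramsP g b : ((g, b) \in params) = row_free (orbmx 4 g) && (N b != 1).
Proof. by rewrite !inE. Qed.

Lemma full_neq0 g : row_free (orbmx 4 g) -> g != 0.
Proof.
move=> gfree; apply/eqP=> g0.
have [|/eqP] := sg_indep gfree (c0 := 1) (c1 := 0) (c2 := 0) (c3 := 0).
  by rewrite !scale0r g0 scaler0 !addr0.
by rewrite oner_eq0.
Qed.

Lemma code_set_eq g b h c : row_free (orbmx 4 g) -> row_free (orbmx 4 h) ->
  (code_set (h, c) == code_set (g, b))
    = (h <= code g b)%MS && (partner h c <= code g b)%MS.
Proof.
move=> gfree hfree; rewrite -col_mx_sub -/(code h c); apply/eqP/idP =>
  [eqS|sub_hg].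
  rewrite col_mx_sub; have inS (v : V) : (v <= code h c)%MS -> (v <= code g
    b)%MS.
    by move/setP/(_ v): eqS; rewrite !inE => ->.
  by rewrite !inS // /code; have := submx_refl (code h c);
    rewrite col_mx_sub => /andP[].
have : (code h c == code g b)%MS.
  rewrite -(geq_leqif (mxrank_leqif_eq sub_hg)).
  by rewrite (eqnP (code_free gfree b)) (eqnP (code_free hfree c)).
by move/eqmxP=> eqC; apply/setP=> v; rewrite !inE eqC.
Qed.

Section Fiber.
Variables (g : V) (b : E).
Hypotheses (gfree : row_free (orbmx 4 g)) (Nb : N b != 1).

Let fiber := [set p in params | code_set p == code_set (g, b)].

Lemma param_fiber (h : V) c : row_free (orbmx 4 h) -> N c != 1 ->
  ((h, c) \in fiber) = (h <= code g b)%MS && (partner h c <= code g b)%MS.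
Proof. by move=> hfree Nc; rewrite inE paramsP hfree Nc code_set_eq. Qed.

Lemma param1_fiber s : s != 0 -> param1 g b s \in fiber.
Proof.
move=> s0; rewrite param_fiber ?orbmxZ //; last first.
  by rewrite cnormM // cnormV !(cnormM, cnorm_phi phiE card_E) mulfK ?cnorm_eq0.
rewrite param1_partner //.
by rewrite !scalemx_sub //; apply/sub_code; [exists 0, 1 | exists 1, 0];
  rewrite scale0r scale1r ?addr0 ?add0r.
Qed.

Lemma param2_fiber t : t != 0 -> b != 0 -> param2 g b t \in fiber.
Proof.
move=> t0 b0; rewrite param_fiber.
- have [k ->] := param2_partner phiE card_E phiP P4 g t0 b0.
  by rewrite !scalemx_sub //; apply/sub_code; [exists 1, 0 | exists 0, 1];
    rewrite scale0r scale1r ?addr0 ?add0r.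
- exact: orbmxZ t0 (partner_orbit phiE card_E phiP P4 gfree Nb).
rewrite cnormN !(cnormM, cnormV, cnorm_phi phiE card_E) invfM mulrA divff
  ?cnorm_eq0 //.
by rewrite mul1r invr_eq1.
Qed.

Lemma fiberP p : reflect
  ((exists2 s, s != 0 & p = param1 g b s)
   \/ b != 0 /\ exists2 t, t != 0 & p = param2 g b t) (p \in fiber).
Proof.
apply: (iffP idP) => [|[[s s0 ->]|[b0 [t t0 ->]]]]; last 2 first.
- exact: param1_fiber.
- exact: param2_fiber.
case: p => h c hc; have := hc; rewrite inE paramsP => /andP[/andP[hfree Nc] _].
rewrite param_fiber // in hc; have /andP[h_sub p_sub] := hc.
exact: (code_param phiE card_E phiP P4 gfree Nb (full_neq0 hfree)).
Qed.

Lemma partner_neq0 : partner g b != 0.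
Proof. exact: full_neq0 (partner_orbit phiE card_E phiP P4 gfree Nb). Qed.

Lemma param1_inj : injective (param1 g b).
Proof.
move=> s t [/eqP + _]; rewrite -subr_eq0 -scalerBl scaler_eq0.
by rewrite (negPf (full_neq0 gfree)) orbF subr_eq0 => /eqP.
Qed.

Lemma param2_inj : injective (param2 g b).
Proof.
move=> s t [/eqP + _]; rewrite -subr_eq0 -scalerBl scaler_eq0.
by rewrite (negPf partner_neq0) orbF subr_eq0 => /eqP.
Qed.

(* The extra weight at p.2 = 0 makes all fibers of code_set equally heavy, although
   those with p.2 = 0 are half as large. *)
Lemma fiber_weight : (\sum_(p in fiber) (1 + (p.2 == 0%R)) = 2 * #|E|.-1)%N.
Proof.
have sum_img (f : E -> V * E) (w : nat) : injective f ->
    (forall s, s != 0 -> (1 + ((f s).2 == 0%R) = w)%N) ->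
    (\sum_(p in [set f s | s in [set~ 0%R]]) (1 + (p.2 == 0%R)) = #|E|.-1 *
      w)%N.
  move=> f_inj fw; rewrite big_imset /=; last by move=> x y _ _; apply: f_inj.
  rewrite -(cardsC1 (0 : E)) -sum_nat_const; apply: eq_bigr => s.
  by rewrite !inE => /fw.
have [b0|b0] := eqVneq b 0.
  have -> : fiber = [set param1 g b s | s in [set~ 0]].
    apply/setP=> p; apply/fiberP/imsetP => [[[s s0 ->]|[]]|[s]].
    - by exists s; rewrite ?inE.
    - by rewrite b0 eqxx.
    by rewrite !inE => s0 ->; left; exists s.
  rewrite (sum_img _ 2) 1?mulnC //; first exact: param1_inj.
  by move=> s s0; rewrite /= b0 !mul0r eqxx.
have -> : fiber = [set param1 g b s | s in [set~ 0]] :|: [set param2 g b s | s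
  in [set~ 0]].
  apply/setP=> p; rewrite in_setU; apply/fiberP/orP =>
    [[[s s0 ->]|[_ [t t0 ->]]]|].
  - by left; apply/imsetP; exists s; rewrite ?inE.
  - by right; apply/imsetP; exists t; rewrite ?inE.
  case=> /imsetP[s]; rewrite !inE => s0 ->; first by left; exists s.
  by right; split=> //; exists s.
under eq_bigl do rewrite in_setU.
rewrite bigU /=; last first.
  rewrite /disjoint; apply/pred0P => p /=; apply/negP => /andP[/imsetP[s]];
    rewrite !inE => s0 -> /imsetP[t].
  rewrite !inE => t0 [/eqP]; rewrite -subr_eq0 => /eqP st _.
  have := code_free gfree b => /row_free_injP/(_ (row_mx s%:M (- t)%:M)).
  rewrite mul_row_col !mul_scalar_mx scaleNr => /(_ st).
  rewrite -row_mx0 => /eq_row_mx[/matrixP/(_ 0 0)]; rewrite !mxE mulr1n => /eqP.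
  by rewrite (negPf s0).
rewrite !(sum_img _ 1) ?mulnDl; [by rewrite muln1 mul2n addnn | exact:
  param2_inj | | exact: param1_inj |].
  move=> s s0; rewrite /= oppr_eq0 mulf_eq0 invr_eq0 mulf_eq0 !fmorph_eq0.
  by rewrite (negPf s0) (negPf b0).
move=> s s0; rewrite /= !mulf_eq0 invr_eq0 !fmorph_eq0.
by rewrite (negPf s0) (negPf b0).
Qed.

End Fiber.

Lemma card_codes : (2 * #|E|.-1 * #|code_set @: params|
  = #|full_vectors| * (#|[set b | N b != 1%R]| + 1))%N.
Proof.
transitivity (\sum_(p in params) (1 + (p.2 == 0%R)))%N.
  rewrite (partition_big_imset code_set) /= mulnC -sum_nat_const.
  apply: eq_bigr => S /imsetP[[g b] gb_in ->].
  have := gb_in; rewrite paramsP => /andP[gfree Nb].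
  rewrite -(fiber_weight gfree Nb); apply: eq_bigl => p; by rewrite !inE.
rewrite big_split /= sum1_card cardsX mulnDr muln1; congr (_ + _)%N.
rewrite (eq_bigr (fun p : V * E => if p.2 == 0%R then 1 else 0)%N); last first.
  by move=> p _; case: (_ == _).
rewrite -big_mkcondr /= sum1dep_card.
transitivity #|setX full_vectors [set 0%R : E]|;
  last by rewrite cardsX cards1 muln1.
apply: eq_card => -[g b]; rewrite !inE /= -andbA; congr (_ && _).
by have [->|_] := eqVneq b 0; rewrite ?andbF // cnorm0 eq_sym oner_eq0.
Qed.

Lemma card_codes_eq : (2 * (q ^ 4 - 1) * #|code_set @: params|
    + #|full_vectors| * (q ^ 3 + q ^ 2 + q) = #|full_vectors| * q ^ 4)%N.
Proof.
rewrite subn1 -card_E card_codes -mulnDr; congr (_ * _)%N.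
rewrite -addnA [(1 + _)%N]addnC -(card_cnorm1 phiE card_E) addnC.
rewrite -[RHS](cardsC [set b | N b == 1]); congr (_ + _)%N.
by apply: eq_card => b; rewrite !inE.
Qed.

End Counting.

(** * Linearized polynomials as coefficient vectors *)

Section FrobeniusOfExtension.
Variables (F : finFieldType) (L : fieldExtType F).
Local Notation q := #|F|.
Local Notation E := (finvect_type L).

Lemma pchar_card_ext : [pchar E].-nat q.
Proof.
have [p p_pr pchF] := finPcharP F.
rewrite (card_pprimeChar pchF) pnatX; apply/orP; left.
by rewrite pnatE // pchar_lalg pchF.
Qed.

Definition frob (x : E) : E := x ^+ q.

Fact frob_additive : {morph frob : x y / x - y}.
Proof.
move=> x y; apply/eqP; rewrite eq_sym subr_eq /frob.
by rewrite -(exprDn_pchar _ _ pchar_card_ext) subrK.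
Qed.

Fact frob_monoid : monoid_morphism frob.
Proof. by split=> [|x y]; rewrite /frob ?expr1n ?exprMn. Qed.

HB.instance Definition _ := GRing.isZmodMorphism.Build E E frob frob_additive.
HB.instance Definition _ := GRing.isMonoidMorphism.Build E E frob frob_monoid.

Hypothesis dimL : \dim {:L} = 4%N.

Lemma card_ext : #|E| = (q ^ 4)%N.
Proof. by rewrite -(card_vspacef (Vector.class E)) (@card_vspace _ _
  (Vector.class E)) dimL. Qed.

Definition shift4 : {perm 'I_4} := perm (@addIr _ (1 : 'I_4)).
Definition shift_mx : 'M[E]_4 := perm_mx shift4.

Lemma frob_shift_mx : map_mx frob shift_mx = shift_mx.
Proof. by apply/matrixP=> i j; rewrite !mxE rmorph_nat. Qed.

Lemma shift_mx4 : shift_mx *m shift_mx *m shift_mx *m shift_mx = 1%:M.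
Proof.
rewrite -!perm_mxM -perm_mx1; congr perm_mx; apply/permP=> i.
by rewrite !permM !permE; case: i => [[|[|[|[|//]]]] lti]; apply: val_inj.
Qed.

Local Notation sg := (@sg E frob shift_mx 1).
Local Notation orbmx := (orbmx frob shift_mx).
Local Notation V := 'rV[E]_4.

Definition ev (v : V) (x : E) : E := \sum_i v 0 i * x ^+ (q ^ i).

Lemma powqD i (x y : E) : (x + y) ^+ (q ^ i) = x ^+ (q ^ i) + y ^+ (q ^ i).
Proof. by apply: exprDn_pchar; rewrite pnatX pchar_card_ext. Qed.

Lemma powqZ i (a : F) (x : E) : (a *: x) ^+ (q ^ i) = a *: x ^+ (q ^ i).
Proof.
rewrite exprZn; congr (_ *: _).
by elim: i => [|i IHi]; rewrite ?expr1 // expnSr exprM IHi expf_card.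
Qed.

Fact ev_linear v : linear (ev v : E -> E).
Proof.
move=> a x y; rewrite /ev scaler_sumr -big_split; apply: eq_bigr => i _ /=.
by rewrite powqD powqZ mulrDr scalerAr.
Qed.

HB.instance Definition _ v := GRing.isLinear.Build F E E *:%R (ev v) (ev_linear
  v).

Lemma evD u v x : ev (u + v) x = ev u x + ev v x.
Proof. by rewrite /ev -big_split; apply: eq_bigr => i _;
  rewrite mxE mulrDl. Qed.

Lemma evZ a v x : ev (a *: v) x = a * ev v x.
Proof. by rewrite /ev mulr_sumr; apply: eq_bigr => i _; rewrite mxE mulrA. Qed.

Lemma ev_sum k (v : 'I_k -> V) x : ev (\sum_i v i) x = \sum_i ev (v i) x.
Proof.
apply: (big_morph (fun v => ev v x)) => [u w|]; first exact: evD.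
by rewrite /ev big1 // => i _; rewrite mxE mul0r.
Qed.

Lemma ev_inj u v : ev u =1 ev v -> u = v.
Proof.
move=> uv; apply/eqP; rewrite -subr_eq0; apply/eqP.
apply: (linearized_eq0 card_ext) => x; have /eqP := uv x.
rewrite -subr_eq0 /ev -sumrB => /eqP uv0; rewrite -[RHS]uv0.
by apply: eq_bigr => i _; rewrite !mxE mulrBl.
Qed.

Lemma ev_sg v x : ev (sg v) x = frob (ev v x).
Proof.
have frob_pow (i : 'I_4) : frob (x ^+ (q ^ i)) = x ^+ (q ^ shift4 i).
  rewrite /frob -exprM -expnSr permE.
  case: i => [[|[|[|[|//]]]] lti] //=; rewrite -[RHS]expr1.
  by rewrite -card_ext expf_card.
rewrite /ev rmorph_sum (reindex_inj (@perm_inj _ shift4)) /=.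
apply: eq_bigr => i _; rewrite rmorphM /= frob_pow; congr (_ * _).
rewrite sgE mxE (bigD1 i) //= !mxE eqxx mulr1 big1 ?addr0 // => j ji.
by rewrite !mxE (inj_eq perm_inj) (negPf ji) mulr0.
Qed.

Lemma ev_iter_sg i v x : ev (iter i sg v) x = (ev v x) ^+ (q ^ i).
Proof. by elim: i => //= i IHi; rewrite ev_sg IHi /frob -exprM -expnSr. Qed.

End FrobeniusOfExtension.

Section Polynomials.
Variables (F : finFieldType) (L : fieldExtType F).
Hypothesis dimL : \dim {:L} = 4%N.
Local Notation q := #|F|.
Local Notation E := (finvect_type L).
Local Notation V := 'rV[E]_4.
Local Notation orbmx := (orbmx (@frob F L) (shift_mx L)).
Local Notation sg := (@sg E (@frob F L) (shift_mx L) 1).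

Definition topoly (v : V) : ambient E :=
  npolyp (q ^ (\dim {:E}).-1).+1 (\sum_(i < 4) v 0 i *: 'X^(q ^ i)).

Lemma topolyE v : topoly v = \sum_(i < 4) v 0 i *: 'X^(q ^ i) :> {poly E}.
Proof.
rewrite npolypK // dimL; apply: (leq_trans (size_sum _ _ _)).
apply/bigmax_leqP => i _; rewrite (leq_trans (size_scale_leq _ _)) //.
by rewrite size_polyXn ltnS leq_exp2l ?finNzRing_gt1 // -ltnS.
Qed.

Fact topoly_linear : linear topoly.
Proof.
move=> a u v; apply: val_inj; rewrite /= !topolyE scaler_sumr -big_split.
by apply: eq_bigr => i _; rewrite !mxE /= scalerDl scalerA.
Qed.

Let topoly_lin : {linear V -> ambient E} :=
  HB.pack topoly (GRing.isLinear.Build E V (ambient E) *:%R topoly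
    topoly_linear).

Lemma topolyD u v : topoly (u + v) = topoly u + topoly v.
Proof. exact: (linearD topoly_lin). Qed.

Lemma topolyZ a v : topoly (a *: v) = a *: topoly v.
Proof. exact: (linearZZ topoly_lin). Qed.

Lemma topoly0 : topoly 0 = 0.
Proof. exact: (linear0 topoly_lin). Qed.

Lemma topoly_sum k (v : 'I_k -> V) : topoly (\sum_i v i) = \sum_i topoly (v i).
Proof. exact: (linear_sum topoly_lin). Qed.

Lemma linearized_topoly (f : ambient E) :
  f \in linearized E <-> exists v, f = topoly v.
Proof.
rewrite linearizedP; have reindex m : m = 4%N ->
    (exists c : 'I_m -> E, polyn f = \sum_(i < m) c i *: 'X^(q ^ i)) <->
    (exists v : V, polyn f = \sum_(i < 4) v 0 i *: 'X^(q ^ i)).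
  move=> ->; split=> [[c ->]|[v ->]]; last by exists (v 0).
  by exists (\row_i c i); apply: eq_bigr => i _; rewrite mxE.
rewrite (reindex _ dimL); split=> [[v fv]|[v ->]]; exists v;
  last exact: topolyE.
by apply: val_inj; rewrite /= topolyE.
Qed.

Lemma horner_topoly v x : (topoly v).[x] = ev v x.
Proof.
by rewrite topolyE horner_sum; apply: eq_bigr => i _; rewrite hornerZ hornerXn.
Qed.

Lemma polyend_topoly v x : polyend (topoly v) x = ev v x.
Proof. by rewrite polyendE ?horner_topoly //; apply/linearized_topoly;
  exists v. Qed.

Lemma topoly_inj : injective topoly.
Proof.
by move=> u v uv; apply: (ev_inj dimL) => x; rewrite -!horner_topoly uv.
Qed.

Lemma powq_sum i n (a : 'I_n -> F) (u : 'I_n -> E) :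
  (\sum_j a j *: u j) ^+ (q ^ i) = \sum_j a j *: u j ^+ (q ^ i).
Proof.
elim/big_rec2: _ => [|j x y _ <-]; last by rewrite powqD powqZ.
by rewrite expr0n expn_eq0 eqn0Ngt (ltnW (finNzRing_gt1 F)).
Qed.

Lemma topoly_eq0 v : (topoly v == 0) = (v == 0).
Proof. by rewrite -topoly0 (inj_eq topoly_inj). Qed.

Lemma rk_ge_free k v : row_free (orbmx k v) -> (k <= rk (topoly v))%N.
Proof.
rewrite leqNgt => /orbmxP freev; apply/negP=> lt_r.
set U := limg (polyend (topoly v)) in lt_r.
pose M : 'M[E]_(k, \dim U) := \matrix_(i, j) ((vbasis U)`_j ^+ (q ^ i)).
have /rowV0Pn[c c_ker c0] : kermx M != 0.
  rewrite kermx_eq0 /row_free; apply: contraTneq lt_r => rM.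
  by rewrite -leqNgt /rk -/U -{1}rM rank_leq_col.
case/negP: c0; apply/eqP/rowP => i; rewrite [RHS]mxE; apply: freev i.
apply: (ev_inj dimL) => x; rewrite ev_sum.
have -> : ev (0 : V) x = 0 by rewrite /ev big1 // => i _; rewrite mxE mul0r.
under eq_bigr do rewrite evZ (ev_iter_sg dimL) -polyend_topoly.
have : polyend (topoly v) x \in U by rewrite memv_img ?memvf.
move: (polyend _ x) => y /coord_vbasis ->.
rewrite (eq_bigr (fun i : 'I_k => \sum_j coord (vbasis U) j y *: (c 0 i *
  (vbasis U)`_j ^+ (q ^ i)))).
  rewrite exchange_big big1 //= => j _; rewrite -scaler_sumr.
  have /rowP/(_ j) := sub_kermxP c_ker; rewrite !mxE.
  by under eq_bigr do rewrite mxE; move=> ->; rewrite scaler0.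
move=> i _; rewrite powq_sum mulr_sumr; apply: eq_bigr => j _.
by rewrite scalerAr.
Qed.

Lemma free_rk_ge k v : (0 < k <= 4)%N -> (k <= rk (topoly v))%N -> row_free
  (orbmx k v).
Proof.
move=> /andP[k0 k4] k_rk; apply/orbmxP => c c_eq0.
pose p : {poly E} := \sum_(i < k) c i *: 'X^(q ^ i).
have q1 : (1 < q)%N := finNzRing_gt1 F.
have size_p : (size p <= (q ^ k.-1).+1)%N.
  apply/(leq_trans (size_sum _ _ _))/bigmax_leqP => i _.
  rewrite (leq_trans (size_scale_leq _ _)) // size_polyXn ltnS leq_exp2l //.
  by rewrite -ltnS prednK.
suff p0 : p = 0.
  move=> i; rewrite -(coef0 E (q ^ i)) -p0 coef_sum (bigD1 i) //=.
  rewrite coefZ coefXn eqxx mulr1 big1 ?addr0 // => j ji.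
  rewrite coefZ coefXn eqn_exp2l //; case: eqP => [ij|]; last by rewrite mulr0.
  by rewrite (val_inj ij) eqxx in ji.
apply/eqP; apply: contraLR size_p => p0; rewrite -ltnNge.
set U := limg (polyend (topoly v)).
have := @max_poly_roots _ p (enum U) p0 _ (enum_uniq _).
rewrite -cardE (@card_vspace _ _ (Vector.class E)) => lt_p.
rewrite (leq_ltn_trans _ (lt_p _)) ?ltnS ?ltn_exp2l // ?(leq_trans _ k_rk)
  ?prednK //.
apply/allP=> y; rewrite mem_enum => /memv_imgP[x _ ->].
rewrite polyend_topoly /root /p horner_sum; apply/eqP.
transitivity (ev (\sum_i c i *: iter i sg v) x).
  rewrite ev_sum; apply: eq_bigr => i _.
  by rewrite hornerZ hornerXn evZ (ev_iter_sg dimL).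
by rewrite c_eq0 /ev big1 // => i _; rewrite mxE mul0r.
Qed.

Lemma row_free_orbmx k v : (0 < k <= 4)%N -> row_free (orbmx k v) = (k <= rk
  (topoly v))%N.
Proof. by move=> k4; apply/idP/idP; [apply: rk_ge_free | apply: free_rk_ge].
  Qed.

Lemma rk_eq4 v : (4 <= rk (topoly v))%N = (lker (polyend (topoly v)) == 0%VS).
Proof.
have dim_sum : (\dim (lker (polyend (topoly v))) + rk (topoly v) = 4)%N.
  by apply: (etrans _ dimL); have := limg_ker_dim (polyend (topoly v)) fullv;
    rewrite capfv.
rewrite -dimv_eq0 -(eqn_add2r (rk (topoly v))) add0n dim_sum eq_sym.
by rewrite eqn_leq -{2}dim_sum leq_addl.
Qed.

End Polynomials.

Section CountFull.
Variables (F : finFieldType) (L : fieldExtType F).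
Hypothesis dimL : \dim {:L} = 4%N.
Local Notation q := #|F|.
Local Notation E := (finvect_type L).
Local Notation V := 'rV[E]_4.
Local Notation full := (full_vectors (@frob F L) (shift_mx L)).

Lemma card_unitmx (K : finFieldType) n : #|[set A : 'M[K]_n.+1 | A \in unitmx]|
  = #|'GL_n.+1[K]%g|.
Proof.
rewrite -(card_imset _ (val_inj : injective (@GLval n.+1 K))).
apply: eq_card => A; rewrite inE; apply/idP/imsetP => [Au|[u _ ->]].
  by exists (FinRing.unit 'M[K]_n.+1 (Au : A \is a GRing.unit)); rewrite ?inE.
exact: (valP u).
Qed.

Lemma card_full_vectors : #|full| = #|'GL_4[F]%g|.
Proof.
have [e e_basis] : exists e : 4.-tuple E, basis_of {:E} e.
  have : exists e : (\dim {:E}).-tuple E, basis_of {:E} e.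
    by exists (vbasis {:E}); apply: vbasisP.
  by rewrite dimL.
have coordE (x : E) : x = \sum_i coord e i x *: e`_i.
  by apply: coord_basis e_basis _; apply: memvf.
pose mat (v : V) : 'M[F]_4 := \matrix_(i, j) coord e j (ev v e`_i).
have mulmat (u : 'rV_4) v j : (u *m mat v) 0 j = coord e j (ev v (\sum_i u 0 i
  *: e`_i)).
  rewrite mxE (linear_sum (ev v)) (linear_sum (coord e j)).
  apply: eq_bigr => i _; rewrite mxE (linearZ_LR (ev v)).
  by rewrite linearZ.
have mat_inj : injective mat.
  move=> u v uv; apply: (ev_inj dimL) => x; rewrite [LHS]coordE [RHS]coordE.
  apply: eq_bigr => j _; congr (_ *: _).
  rewrite [x]coordE.
  have mE w : coord e j (ev w (\sum_i coord e i x *: e`_i)) = (\row_i coord e i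
    x *m mat w) 0 j.
    by rewrite mulmat; do 2 congr (_ _); apply: eq_bigr => i _; rewrite mxE.
  by rewrite !mE uv.
have matE v : (v \in full) = (mat v \in unitmx).
  rewrite inE (row_free_orbmx dimL) // (rk_eq4 dimL) -row_free_unit.
  apply/idP/row_free_injP => [/lker0P inj_v u u0|mat_v].
    have : \sum_i u 0 i *: e`_i = 0 :> E.
      apply: inj_v; rewrite !(polyend_topoly dimL) [RHS]linear0 [LHS]coordE.
      by apply: big1 => j _; rewrite -mulmat u0 mxE scale0r.
    by move/(freeP (basis_free e_basis)) => u00; apply/rowP=> i;
      rewrite u00 mxE.
  apply/lker0P => x y; rewrite !(polyend_topoly dimL) => xy.
  apply/eqP; rewrite -subr_eq0 [x - y]coordE; apply/eqP/big1 => i _.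
  have /rowP/(_ i) : \row_i coord e i (x - y) = 0.
    apply: mat_v; apply/rowP=> j; rewrite mulmat mxE.
    have -> : \sum_i (\row_i0 coord e i0 (x - y)) 0 i *: e`_i = x - y.
      by rewrite [RHS]coordE; apply: eq_bigr => i0 _; rewrite mxE.
    by rewrite linearB /= xy subrr linear0.
  by rewrite !mxE => ->; rewrite scale0r.
rewrite -card_unitmx -(card_imset _ mat_inj).
have mat_bij : bijective mat.
  apply: (inj_card_bij mat_inj); rewrite !card_mx (card_ext dimL) -expnM.
  exact: leqnn.
apply: eq_card => A; rewrite inE; apply/imsetP/idP => [[v + ->]|Au].
  by rewrite matE.
by have [mat' matK mat'K] := mat_bij; exists (mat' A); rewrite ?matE mat'K.
Qed.

End CountFull.

(** * Counting the MRD codes *)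

Section CountMRD.
Variables (F : finFieldType) (L : fieldExtType F).
Hypothesis dimL : \dim {:L} = 4%N.
Local Notation q := #|F|.
Local Notation E := (finvect_type L).
Local Notation V := 'rV[E]_4.
Local Notation frob := (@frob F L).
Local Notation shift_mx := (shift_mx L).
Local Notation orbmx := (orbmx frob shift_mx).
Local Notation code := (code frob shift_mx).
Local Notation partner := (partner frob shift_mx).
Local Notation code_set := (code_set frob shift_mx).
Local Notation params := (params frob shift_mx).
Local Notation card_E := (card_ext dimL).
Local Notation frobP := (frob_shift_mx L).
Local Notation shift4 := (shift_mx4 L).
Let frobE (x : E) : frob x = x ^+ q := erefl.

Definition span_of (S : {set V}) : {vspace ambient E} :=
  <<[seq topoly v | v <- enum S]>>%VS.

Lemma mem_span_code g b (f : ambient E) :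
  f \in span_of (code_set (g, b)) <-> exists2 v, (v <= code g b)%MS & f =
    topoly v.
Proof.
split=> [|[v v_code ->]]; last first.
  by rewrite memv_span // map_f // mem_enum inE.
have sub_gb : (span_of (code_set (g, b)) <= <[topoly g]> + <[topoly (partner g
  b)]>)%VS.
  apply/span_subvP => _ /mapP[v + ->]; rewrite mem_enum inE =>
    /sub_code[s [t ->]].
  rewrite (topolyD dimL) !(topolyZ dimL).
  by apply: memv_add; apply: memvZ; apply: memv_line.
move=> /(subvP sub_gb)/memv_addP[_ /vlineP[s ->] [_ /vlineP[t ->] ->]].
exists (s *: g + t *: partner g b); last first.
  by rewrite (topolyD dimL (s *: g)) !(topolyZ dimL).
by apply/sub_code; exists s, t.
Qed.

Lemma span_code g b : span_of (code_set (g, b)) = <<[:: topoly g;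
  topoly (partner g b)]>>%VS.
Proof.
apply/eqP; rewrite eqEsubv; apply/andP; split.
  apply/subvP => f /mem_span_code[v /sub_code[s [t ->]] ->].
  rewrite span_cons span_seq1 (topolyD dimL) !(topolyZ dimL).
  by apply: memv_add; apply: memvZ; apply: memv_line.
apply/span_subvP => f; rewrite !inE => fE; apply/mem_span_code.
have sub_gp (M := code g b) := submx_refl M;
  rewrite {1}/code col_mx_sub in sub_gp.
by case/andP: sub_gp => gS pS; case/orP: fE => /eqP->;
  [exists g | exists (partner g b)].
Qed.

Lemma dim_span_code g b : row_free (orbmx 4 g) -> \dim (span_of (code_set (g,
  b))) = 2%N.
Proof.
move=> gfree; rewrite span_code; apply/eqP.
rewrite -[2%N]/(size [:: topoly g; topoly (partner g b)]) -/(free _).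
have pfree := code_free gfree b.
rewrite free_cons seq1_free span_seq1; apply/andP; split.
  apply/vlineP=> -[k]; rewrite -(topolyZ dimL) => /(topoly_inj dimL) gE.
  have /row_free_injP/(_ (row_mx 1%:M (- k)%:M)) := pfree.
  rewrite mul_row_col !mul_scalar_mx scale1r scaleNr -gE subrr => /(_ erefl).
  rewrite -row_mx0 => /eq_row_mx[/matrixP/(_ 0 0)].
  by rewrite !mxE => /eqP; rewrite oner_eq0.
rewrite (topoly_eq0 dimL); apply/eqP=> p0.
have /row_free_injP/(_ (row_mx 0 1%:M)) := pfree.
rewrite mul_row_col mul0mx mul1mx add0r => /(_ p0).
rewrite -row_mx0 => /eq_row_mx[_ /matrixP/(_ 0 0)].
by rewrite !mxE => /eqP; rewrite oner_eq0.
Qed.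

Lemma code_vanishing_at1 g b : row_free (orbmx 4 g) -> cnorm frob b != 1 ->
  exists v : V, [/\ (v <= code g b)%MS, v != 0 & ev v 1 = 0].
Proof.
move=> gfree Nb; have pfree := partner_orbit frobE card_E frobP shift4 gfree Nb.
have [p1|p1] := eqVneq (ev (partner g b) 1) 0.
  exists (partner g b); split=> //; last exact: full_neq0 pfree.
  by apply/sub_code; exists 0, 1; rewrite scale0r add0r scale1r.
pose s := ev (partner g b) 1; pose t := - ev g 1.
exists (s *: g + t *: partner g b); split.
- by apply/sub_code; exists s, t.
- apply: contra_neq p1 => v0; have /row_free_injP/(_ (row_mx s%:M t%:M)) :=
  code_free gfree b.
  rewrite mul_row_col !mul_scalar_mx => /(_ v0).
  rewrite -row_mx0 => /eq_row_mx[/matrixP/(_ 0 0)].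
  by rewrite !mxE mulr1n.
by rewrite evD !evZ mulNr mulrC subrr.
Qed.

Lemma span_code_MRD p : p \in params ->
  is_MRD (span_of (code_set p)) /\ \dim (span_of (code_set p)) = 2%N.
Proof.
case: p => g b; rewrite paramsP => /andP[gfree Nb].
have dimC := dim_span_code b gfree; split=> //.
have rk_ge3 f : f \in span_of (code_set (g, b)) -> f != 0 -> (3 <= rk f)%N.
  move=> /mem_span_code[v v_code ->].
  rewrite (topoly_eq0 dimL) => v0.
  rewrite -(row_free_orbmx dimL) //.
  exact: (code_mrd frobE card_E frobP shift4 gfree Nb v_code v0).
split.
  split; last by apply/eqP; rewrite -dimv_eq0 dimC.
  by apply/subvP=> f /mem_span_code[v _ ->]; apply/(linearized_topoly dimL);
    exists v.
have -> : (\dim {:E} - \dim (span_of (code_set (g, b))) + 1 = 3)%N by rewrite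
  dimC dimL.
split=> //; have [v [v_code v0 v1]] := code_vanishing_at1 gfree Nb.
have v_in : topoly v \in span_of (code_set (g, b)) by apply/mem_span_code;
  exists v.
exists (topoly v); split=> //; first by rewrite (topoly_eq0 dimL).
apply/eqP; rewrite eqn_leq rk_ge3 ?(topoly_eq0 dimL) // andbT.
rewrite leqNgt (rk_eq4 dimL); apply/negP => /lker0P/(_ 1 0).
rewrite !(polyend_topoly dimL) v1 linear0 => /(_ erefl)/eqP.
by rewrite oner_eq0.
Qed.

Lemma MRD_span_code (C : {vspace ambient E}) : is_MRD C -> \dim C = 2%N ->
  exists2 p, p \in params & C = span_of (code_set p).
Proof.
move=> [[C_lin _] [_ C_rk]] dimC.
have d3 : (\dim {:E} - \dim C + 1 = 3)%N by rewrite dimC dimL.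
rewrite d3 in C_rk.
have [X X_basis] : exists X : 2.-tuple (ambient E), basis_of C X.
  have : exists X : (\dim C).-tuple (ambient E), basis_of C X.
    by exists (vbasis C); apply: vbasisP.
  by rewrite dimC.
have X_C (i : 'I_2) : X`_i \in C by apply: (basis_mem X_basis);
  rewrite mem_nth ?size_tuple.
have topolyV (i : 'I_2) : exists v, X`_i == topoly v.
  have [v ->] := (linearized_topoly dimL X`_i).1 (subvP C_lin _ (X_C i)).
  by exists v.
pose B : 'M[E]_(2, 4) := \matrix_i xchoose (topolyV i).
have topolyB u : topoly (u *m B) = \sum_i u 0 i *: X`_i.
  rewrite mulmx_sum_row (topoly_sum dimL); apply: eq_bigr => i _.
  rewrite (topolyZ dimL) rowK; congr (_ *: _); apply/esym/eqP.
  exact: (xchooseP (topolyV i)).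
have B_C v : (v <= B)%MS -> topoly v \in C.
  by move=> /submxP[u ->]; rewrite topolyB memv_suml // => i _; rewrite memvZ.
have Bfree : row_free B.
  apply/row_free_injP => u u0; have := topolyB u; rewrite u0 (topoly0 dimL) =>
    /esym.
  by move/(freeP (basis_free X_basis)) => u00; apply/rowP=> i; rewrite u00 mxE.
have Bmrd (x : 'rV_2) : x != 0 -> row_free (orbmx 3 (x *m B)).
  move=> x0; rewrite (row_free_orbmx dimL) //; apply: C_rk.
    by rewrite B_C // submxMl.
  rewrite (topoly_eq0 dimL).
  by apply: contra_neq x0; apply: (row_free_injP _ Bfree).
have [g [b [gfree Nb gB pB]]] :=
  mrd_generator frobE card_E (pchar_card_ext L) frobP shift4 Bfree Bmrd.
exists (g, b); first by rewrite paramsP gfree.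
apply/esym/eqP; rewrite eqEdim dim_span_code // dimC leqnn andbT span_code.
by apply/span_subvP => f; rewrite !inE => /orP[] /eqP->; apply: B_C.
Qed.

Lemma num_MRD_card : num_MRD E 2 = #|code_set @: params|.
Proof.
rewrite /num_MRD.
have -> : [set C : {vspace ambient E} | is_MRD C /\ \dim C = 2%N]%classic =
   [set` [fset span_of S | S in code_set @: params]%fset]%classic.
  apply/seteqP; split=> C /=.
    move=> [/MRD_span_code + dimC] => /(_ dimC)[p pP ->].
    by apply/imfsetP; exists (code_set p); rewrite //= imset_f.
  by move=> /imfsetP[_ /= /imsetP[p pP ->] ->]; apply: span_code_MRD.
rewrite set_fsetK card_in_imfset /=; last first.
  move=> _ _ /imsetP[[g b] _ ->] /imsetP[[h c] _ ->] eqS.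
  apply/setP=> v; rewrite !inE.
  have memE g' b' : (v <= code g' b')%MS <-> topoly v \in span_of (code_set
    (g', b')).
    split=> [v_code|/mem_span_code[w w_code /(topoly_inj dimL)->] //].
    by apply/mem_span_code; exists v.
  by apply/idP/idP => /memE; [rewrite eqS | rewrite -eqS] => /memE.
by rewrite cardE.
Qed.

End CountMRD.

Theorem corollary4p5 (q : nat) (F : finFieldType) (L : fieldExtType F)
    (cardF : #|F| = q) (q_gt2 : (2 < q)%N) (dimL : \dim {:L} = 4%N) :
  (num_MRD L 2)%:R =
    1 / 2 * q%:R ^+ 7 * (q%:R ^+ 3 - 1) * (q%:R ^+ 2 - 1) * (q%:R - 1)
      * (q%:R ^+ 3 - q%:R ^+ 2 - q%:R - 1) :> rat.
Proof.
have count := card_codes_eq (fun x : finvect_type L =>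
  erefl : frob x = x ^+ #|F|)
  (card_ext dimL) (frob_shift_mx L) (shift_mx4 L).
move: count; rewrite -(num_MRD_card dimL) (card_full_vectors dimL) card_GL //
  cardF.
have -> : num_MRD L 2 = num_MRD (finvect_type L) 2 by [].
move: (num_MRD _ 2) => M.
have q1 : (0 < q)%N by rewrite (ltn_trans _ q_gt2).
have qn i : ((q ^ i - 1)%:R = q%:R ^+ i - 1 :> rat).
  by rewrite natrB ?expn_gt0 ?q1 // natrX.
rewrite /index_iota !big_cons big_nil /=.
move/(congr1 (fun n => n%:R : rat)); rewrite !(natrD, natrM, natrX, qn).
have : q%:R ^+ 4 - 1 != 0 :> rat.
  rewrite -qn Num.Theory.pnatr_eq0 subn_eq0 -ltnNge -(exp1n 4) ltn_exp2r //.
  by rewrite (ltn_trans _ q_gt2).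
move: (q%:R : rat) (M%:R : rat) => Q m Q4 eqm.
have two0 : 2 != 0 :> rat by [].
apply: (mulfI (mulf_neq0 two0 Q4)); move/esym/eqP: eqm.
rewrite -subr_eq => /eqP <-; rewrite (_ : 'C(4, 2) = 6)%N //.
by field.
Qed.
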